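(* Let $X$ be, under $\mathbf{P}^\mu_0$, a Brownian motion with drift $\mu$ started from $0$. For all $\alpha,\beta\ge0$ with $\alpha+\beta>0$ and all $u>0$, $$\mathbf{P}^\mu_0(D^-_{H_\beta}<u,\ H_\beta<H_{-\alpha})=\begin{cases}\exp\left(-\dfrac{\beta}{S^{-\mu}(u)}\right),& u\le\alpha,\\[2mm] \dfrac{S^\mu(\alpha)}{S^\mu(u)}\exp\left(-\dfrac{\beta+\alpha-u}{S^{-\mu}(u)}\right),&\alpha\le u\le\alpha+\beta,\\[2mm] \dfrac{S^\mu(\alpha)}{S^\mu(\alpha+\beta)},&\alpha+\beta\le u.\end{cases}$$ In particular, $$\mathbf{P}^\mu_0(D^-_{H_\beta}<u)=\exp\left(-\frac{\beta}{S^{-\mu}(u)}\right).$$ For standard Brownian motion, i.e. $\mu=0$, these two formulas for $\mathbf{P}^\mu_0(D^-_{H_\beta}<u,\ H_\beta<H_{-\alpha})$ and $\mathbf{P}^\mu_0(D^-_{H_\beta}<u)$ hold with $S^0(u)=u$, that is, $$\mathbf{P}^0_0(D^-_{H_\beta}<u,\ H_\beta<H_{-\alpha})=\begin{cases}\exp\left(-\dfrac{\beta}{u}\right),& u\le\alpha,\\[2mm] \dfrac{\alpha}{u}\exp\left(-\dfrac{\beta+\alpha-u}{u}\right),&\alpha\le u\le\alpha+\beta,\\[2mm] \dfrac{\alpha}{\alpha+\beta},&\alpha+\beta\le u,\end{cases}$$ and $$\mathbf{P}^0_0(D^-_{H_\beta}<u)=\exp\left(-\frac{\beta}{u}\right)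.$$
   Context: $H_y:=\inf\{t:X_t=y\}$ (with $\inf\emptyset=+\infty$), and $D^-_{H_\beta}:=\sup\{X_s-X_t:0\le s\le t\le H_\beta\}$ (over all finite $s\le t$ if $H_\beta=+\infty$) is the maximum decrease up to $H_\beta$. For real $\nu\neq0$, $S^\nu(x):=\frac1{2\nu}(1-e^{-2\nu x})$ is the scale function of Brownian motion with drift $\nu$, and $S^0(x):=x$. *)

(* Defs.v *)
From HB Require Import structures.
From mathcomp Require Import all_boot all_order all_algebra.
From mathcomp Require Import all_classical all_reals all_analysis.

Set Implicit Arguments.
Unset Strict Implicit.
Unset Printing Implicit Defensive.

Import Order.TTheory GRing.Theory Num.Theory.
Import numFieldNormedType.Exports.

Local Open Scope classical_set_scope.
Local Open Scope ring_scope.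

(* Taking some of the B i to be setT gives the product rule for every
   subfamily. *)
Definition mutually_independent {d : measure_display} {T : measurableType d}
    {R : realType} (P : probability T R) (n : nat) (Y : 'I_n -> T -> R) : Prop :=
  forall B : 'I_n -> set R, (forall i, measurable (B i)) ->
    P (\bigcap_(i in [set: 'I_n]) (Y i @^-1` B i)) =
    (\prod_(i < n) P (Y i @^-1` B i))%E.

(* Time is [0, +oo[; the values of X at negative times are irrelevant.
   All paths are continuous, as on the canonical path space; no completeness of
   P is assumed, so this is what makes the hitting times measurable.
   The condition s < t is strict because the parameter of normal_prob is a
   standard deviation, with a junk value at 0. *)
Record brownian_motion {d : measure_display} {T : measurableType d}
    {R : realType} (P : probability T R) (mu x : R) (X : R -> {RV P >-> R})
    : Prop := {
  bm_start : {ae P, forall w, X 0 w = x} ;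
  bm_continuous : forall w, {within `[0, +oo[, continuous (fun t => X t w)} ;
  bm_increment : forall s t, 0 <= s -> s < t ->
    forall B : set R, measurable B ->
      P ((fun w => X t w - X s w) @^-1` B) =
      normal_prob (mu * (t - s)) (Num.sqrt (t - s)) B ;
  bm_independent : forall (n : nat) (t : nat -> R), 0 <= t 0%N ->
    (forall i, (i < n)%N -> t i <= t i.+1) ->
    mutually_independent P (fun (i : 'I_n) w => X (t i.+1) w - X (t i) w)
}.

Definition hitting_time {R : realType} (f : R -> R) (y : R) : \bar R :=
  ereal_inf [set t%:E | t in [set t : R | 0 <= t /\ f t = y]].

Definition max_decrease {R : realType} (f : R -> R) (h : \bar R) : \bar R :=
  ereal_sup [set z | exists s t : R,
    [/\ 0 <= s, s <= t, (t%:E <= h)%E & z = (f s - f t)%:E]].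

Definition scale {R : realType} (nu x : R) : R :=
  if nu == 0 then x else (2 * nu)^-1 * (1 - expR (- 2 * nu * x)).

Definition decrease_lt {d : measure_display} {T : measurableType d}
    {R : realType} (X : R -> T -> R) (beta u : R) : set T :=
  [set w | (max_decrease (X ^~ w) (hitting_time (X ^~ w) beta) < u%:E)%E].

Definition hits_before {d : measure_display} {T : measurableType d}
    {R : realType} (X : R -> T -> R) (y z : R) : set T :=
  [set w | (hitting_time (X ^~ w) y < hitting_time (X ^~ w) z)%E].

(* Main.v *)
Require Import Defs.
From HB Require Import structures.
From mathcomp Require Import all_boot all_order all_algebra.
From mathcomp Require Import all_classical all_reals all_analysis.
From mathcomp Require Import measurable_realfun ring lra.

Set Implicit Arguments.
Unset Strict Implicit.
Unset Printing Implicit Defensive.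

Import Order.TTheory GRing.Theory Num.Theory.
Import numFieldNormedType.Exports.

Local Open Scope classical_set_scope.
Local Open Scope ring_scope.

(** Why the formula holds.  Let S be the scale function S^mu, so that S(X) is a
    local martingale.  A path that starts at level x without having dropped by
    u reaches the level x + d before x - u with probability S(u) / S(u + d),
    and before x + d - u with probability S(u - d) / S(u).  If the maximum
    decrease before the time H_beta is smaller than u, the first event happens
    on every one of n steps of length d = beta / n; conversely, if the second
    happens on every step then no decrease reaches u.  So the probability lies
    between two n-th powers, and since S(u + d) / S(u) = 1 + S(d) / S^{-mu}(u)
    both tend to exp(- beta / S^{-mu}(u)).  The barrier - alpha only matters
    until the path has climbed to v - a, where a = min(u, alpha) and
    v = min(u, alpha + beta): up to that level the two constraints amount to
    not touching - a (one exit problem, with probability S(a) / S(v)), and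
    after it the barrier is protected by the bound on the decrease.  The three
    cases of the statement are the three possible values of the pair (a, v),
    and the remaining length to be climbed is l = beta + a - v.  The second
    formula is the case alpha = u of the first: a path whose decrease stays
    below u never reaches - u, and almost surely it does reach beta, because it
    cannot stay in the bounded interval between - u and beta for ever.

    The exit problem (gambler_ruin) must be solved from the random time at
    which the previous level is reached.  Neither the strong Markov property
    nor stochastic integration is used: optional_stopping compares the values
    of exp(l X) at two stopping times s <= t directly.  On a grid of mesh h,
    the sum of the increments of exp(l X) over the grid times k h with
    s <= k h < t has a known sign in mean, because the event s <= k h < t
    belongs to the past of k h, of which the next increment is independent
    (indep_past), and because the moment generating function of that increment
    is exp(h (l mu + l^2 / 2)).  Continuity of paths makes these sums converge
    to exp(l X_t) - exp(l X_s); replacing exp(l X) by a bounded function that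
    agrees with it near the interval between the barriers makes bounded
    convergence applicable, at a price that vanishes with the mesh.
    For mu <> 0 the exponent l = - 2 mu gives the scale function itself; for
    mu = 0 every exponent gives an inequality, and the first order term at
    l = 0 gives the equality for S(x) = x (first_order_eq0).

    All this is done for a process that is 0 at time 0 on every path
    (joint_law).  Subtracting X_0 = 0 (almost surely) reduces the general case
    to that one (recentred_eq), once the events are known to be measurable. *)

(** * Normal laws and independent factors *)

Lemma ge0_integral_normal_prob (R : realType) (m s : R) (f : measurableTypeR R -> \bar R) :
  measurable_fun setT f -> (forall x, 0 <= f x)%E ->
  (\int[normal_prob m s]_x f x =
   \int[lebesgue_measure]_x (f x * (normal_pdf m s x)%:E))%E.
Proof.
move=> mf f0.
pose nu : {finite_measure set _ -> \bar R} := normal_prob m s.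
have dom : nu `<< lebesgue_measure := normal_prob_dominates m s.
rewrite -(Radon_Nikodym_SigmaFinite.change_of_variables dom)//.
apply: ae_eq_integral => //.
- apply: emeasurable_funM => //.
  exact: measurable_int (Radon_Nikodym_SigmaFinite.f_integrable dom).
- apply: emeasurable_funM => //; apply/measurable_EFinP.
  exact: measurable_normal_pdf.
- apply: ae_eqe_mul2l; apply: integral_ae_eq => //.
  + exact: Radon_Nikodym_SigmaFinite.f_integrable.
  + by apply/measurable_EFinP; exact: measurable_normal_pdf.
  + by move=> A _ mA; rewrite -Radon_Nikodym_SigmaFinite.f_integral.
Qed.

(** Completing the square turns the density times exp(l x) into a constant
    times the density of another normal law, whose integral is 1. *)
Lemma normal_mgf (R : realType) (m s l : R) : s != 0 ->
  (\int[normal_prob m s]_x (expR (l * x))%:E =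
   (expR (l * m + l ^+ 2 * s ^+ 2 / 2))%:E)%E.
Proof.
move=> s0; rewrite ge0_integral_normal_prob; last 2 first.
- apply/measurable_EFinP; apply: measurableT_comp => //.
- by move=> x; rewrite lee_fin expR_ge0.
under eq_integral => x _.
  rewrite -EFinM (_ : expR (l * x) * normal_pdf m s x =
    expR (l * m + l ^+ 2 * s ^+ 2 / 2) * normal_pdf (m + l * s ^+ 2) s x);
    last first.
    rewrite !normal_pdfE// mulrCA [RHS]mulrCA; congr (_ * _).
    rewrite /normal_fun -!expRD; congr expR.
    by rewrite -[s ^+ 2 *+ 2]mulr_natr; field.
  rewrite EFinM.
over.
rewrite ge0_integralZl//; last 2 first.
- by apply/measurable_EFinP; exact: measurable_normal_pdf.
- by move=> x _; rewrite lee_fin normal_pdf_ge0.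
by rewrite integral_normal_pdf mule1.
Qed.

Lemma normal_prob_itv_le (R : realType) (m s a b : R) : s != 0 -> a <= b ->
  (normal_prob m s `[a, b]%classic <= (normal_peak s * (b - a))%:E)%E.
Proof.
move=> s0 ab; rewrite /normal_prob.
apply: (@le_trans _ _ (\int[lebesgue_measure]_(x in `[a, b]) (normal_peak s)%:E)%E).
  apply: ge0_le_integral => //=.
  - by move=> x _; rewrite lee_fin normal_pdf_ge0.
  - apply/measurable_funTS/measurable_EFinP; exact: measurable_normal_pdf.
  - by move=> x _; rewrite lee_fin normal_pdf_ub.
rewrite integral_cst//= lebesgue_measure_itv/= lte_fin.
case: ltP => ab'; first by rewrite -EFinD -EFinM.
by rewrite mule0 lee_fin mulr_ge0 ?subr_ge0 ?normal_peak_ge0.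
Qed.

(** The joint law of two variables that satisfy the product rule on rectangles
    is the product of their laws, so Tonelli applies. *)
Lemma ge0_integral_indep d (T : measurableType d) (R : realType)
    (P : probability T R) (U V : {mfun T >-> R}) :
  (forall w, 0 <= U w) -> (forall w, 0 <= V w) ->
  (forall A B, measurable A -> measurable B ->
    P (U @^-1` A `&` V @^-1` B) = P (U @^-1` A) * P (V @^-1` B))%E ->
  (\int[P]_w (U w * V w)%:E = \int[P]_w (U w)%:E * \int[P]_w (V w)%:E)%E.
Proof.
move=> U0 V0 UV.
have mUV : measurable_fun setT (fun w => (U w, V w)) by exact: measurable_fun_pair.
pose UVm : {mfun T >-> (R * R)%type} :=
  HB.pack (fun w => (U w, V w)) (isMeasurableFun.Build _ _ _ _ _ mUV).
(* The truncation at 0 makes the integrand nonnegative on the whole plane, as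
   Tonelli requires; it is invisible on the range of (U, V). *)
pose f (p : R * R) := ((Num.max p.1 0) * (Num.max p.2 0))%:E.
have mf : measurable_fun setT f.
  apply/measurable_EFinP/measurable_funM => //.
    by apply: measurable_maxr => //; exact: measurable_fst.
  by apply: measurable_maxr => //; exact: measurable_snd.
have f0 : forall p, (0 <= f p)%E.
  by move=> p; rewrite lee_fin mulr_ge0// le_max lexx orbT.
transitivity (\int[distribution P UVm]_p f p)%E.
  rewrite ge0_integral_pushforward//=.
  apply: eq_integral => w _; rewrite /f/= !max_l//.
transitivity (\int[distribution P U \x distribution P V]_p f p)%E.
  apply: eq_measure_integral => A mA _; apply/esym.
  by apply: product_measure_unique => // A1 A2 mA1 mA2; exact: UV.
rewrite fubini_tonelli1//.
transitivity (\int[distribution P U]_x ((Num.max x 0)%:E * \int[P]_w (V w)%:E))%E.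
  apply: eq_integral => x _; rewrite /fubini_F /f /=.
  under eq_integral do rewrite EFinM.
  rewrite ge0_integralZl//=.
  - rewrite ge0_integral_pushforward//=.
      by congr (_ * _)%E; apply: eq_integral => w _ /=; rewrite max_l.
    by apply/measurable_EFinP; apply: measurable_maxr => //.
    by move=> y _; rewrite lee_fin le_max lexx orbT.
  - by apply/measurable_EFinP; apply: measurable_maxr => //.
  - by move=> y _; rewrite lee_fin le_max lexx orbT.
  - by rewrite lee_fin le_max lexx orbT.
rewrite ge0_integralZr//=.
- rewrite ge0_integral_pushforward//=.
    by congr (_ * _)%E; apply: eq_integral => w _ /=; rewrite max_l.
  by apply/measurable_EFinP; apply: measurable_maxr => //.
  by move=> y _; rewrite lee_fin le_max lexx orbT.
- by apply/measurable_EFinP; apply: measurable_maxr => //.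
- by move=> y _; rewrite lee_fin le_max lexx orbT.
- by apply: integral_ge0 => w _; rewrite lee_fin.
Qed.

(** * The past of a process and its independence of later increments *)

Section natural_filtration.
Context d (T : measurableType d) (R : realType).
Implicit Types X : R -> T -> R.

Definition increment X (s t : R) : T -> R := fun w => X t w - X s w.

(** The natural filtration: the sigma-algebra generated by the process up to
    time t. *)
Definition past X (t : R) : set (set T) :=
  <<s [set A | exists s (B : set R),
        [/\ 0 <= s, s <= t, measurable B & A = X s @^-1` B]] >>.

Lemma past_preimage X s t (B : set R) : 0 <= s -> s <= t -> measurable B ->
  past X t (X s @^-1` B).
Proof. by move=> s0 st mB; apply: sub_sigma_algebra; exists s, B. Qed.

Lemma past_le X s t : s <= t -> past X s `<=` past X t.
Proof.
move=> st; apply: smallest_sub; first exact: smallest_sigma_algebra.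
move=> _ [r [B [r0 rs mB ->]]]; apply: past_preimage => //.
exact: le_trans st.
Qed.

Lemma pastC X t A : past X t A -> past X t (~` A).
Proof.
rewrite /past; set G := [set B | _] => GA; rewrite -setTD.
by have [_ + _] := @smallest_sigma_algebra _ setT G; apply.
Qed.

Lemma pastT X t : past X t setT.
Proof. by rewrite -setC0; apply: pastC; exact: sigma_algebra0. Qed.

Lemma past_bigcup X t (A : (set T)^nat) :
  (forall i, past X t (A i)) -> past X t (\bigcup_i A i).
Proof. exact: sigma_algebra_bigcup. Qed.

Lemma past_bigcap X t (A : (set T)^nat) :
  (forall i, past X t (A i)) -> past X t (\bigcap_i A i).
Proof.
move=> pA; rewrite -[X in past _ _ X]setCK; apply: pastC; rewrite setC_bigcap.
by apply: past_bigcup => i; exact: pastC.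
Qed.

Lemma pastU X t A B : past X t A -> past X t B -> past X t (A `|` B).
Proof.
move=> pA pB; rewrite -bigcup2E; apply: past_bigcup => -[|[|i]] //=.
exact: sigma_algebra0.
Qed.

Lemma pastI X t A B : past X t A -> past X t B -> past X t (A `&` B).
Proof.
move=> pA pB; rewrite -(setCK (A `&` B)) setCI.
by apply: pastC; apply: pastU; apply: pastC.
Qed.

Lemma past_measurable X t : (forall s, measurable_fun setT (X s)) ->
  past X t `<=` measurable.
Proof.
move=> mX; apply: smallest_sub; first exact: sigma_algebra_measurable.
move=> _ [s [B [_ _ mB ->]]]; rewrite -[X in measurable X]setTI.
exact: mX.
Qed.

End natural_filtration.

Section independence.
Context d (T : measurableType d) (R : realType) (P : probability T R).

(** The sets independent of C form a lambda-system. *)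
Lemma indep_pi_lambda (G : set (set T)) (C : set T) :
  measurable C -> setI_closed G -> G `<=` measurable ->
  (forall A, G A -> P (A `&` C) = P A * P C)%E ->
  forall A, <<s G >> A -> P (A `&` C) = (P A * P C)%E.
Proof.
move=> mC IG mG GE A GA.
suff: <<s G >> `<=` [set A | measurable A /\ P (A `&` C) = (P A * P C)%E].
  by move=> /(_ _ GA)[].
apply: lambda_system_subset => //; last first.
  by move=> B GB; split; [exact: mG|exact: GE].
apply/dynkin_lambda_system; split => /=.
- by split; rewrite ?setTI// probability_setT mul1e.
- move=> B [mB BE]; split; first exact: measurableC.
  rewrite setIC -setDE measureD//; last first.
    by rewrite (le_lt_trans (probability_le1 P mC))// ltry.
  rewrite probability_setC// muleBl//; last first.
    exact: fin_num_measure.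
  by rewrite mul1e (setIC C B); congr (_ - _)%E; exact: BE.
- move=> F tF FE; split; first by apply: bigcup_measurable => k _; case: (FE k).
  rewrite setI_bigcupl !measure_bigcup//.
  + rewrite muleC -(fineK (fin_num_measure P C mC)) -nneseriesZl//.
    by apply: eq_eseriesr => k _; rewrite fineK ?fin_num_measure// muleC; case: (FE k).
  + by move=> k _; case: (FE k).
  + by move=> k _; apply: measurableI => //; case: (FE k).
  + exact: trivIset_setIr.
Qed.

Variables (mu : R) (X : R -> {RV P >-> R}).
Hypotheses (hX : brownian_motion mu 0 X) (X0 : forall w, X 0 w = 0).

(** The product rule for the increments along one grid, with the last factor
    isolated, gives the independence of the sigma-algebra of the first n
    increments by the pi-lambda theorem. *)
Lemma indep_grid (n : nat) (t : nat -> R) (C : set R) : 0 <= t 0%N ->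
  (forall i, (i < n.+1)%N -> t i <= t i.+1) -> measurable C ->
  forall A, <<s [set A | exists2 B : nat -> set R, forall i, measurable (B i) &
     A = \bigcap_(i in `I_n) (increment X (t i) (t i.+1) @^-1` B i)] >> A ->
  P (A `&` increment X (t n) (t n.+1) @^-1` C) =
  (P A * P (increment X (t n) (t n.+1) @^-1` C))%E.
Proof.
move=> t0 tn mC.
have mincr i B : measurable B ->
    measurable (increment X (t i) (t i.+1) @^-1` B).
  move=> mB; rewrite -[X in measurable X]setTI.
  by apply: measurable_funB.
apply: indep_pi_lambda.
- exact: mincr.
- move=> _ _ [B1 mB1 ->] [B2 mB2 ->]; exists (fun i => B1 i `&` B2 i).
    by move=> i; exact: measurableI.
  by rewrite -bigcapI; apply: eq_bigcapr => i _; rewrite preimage_setI.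
- move=> _ [B mB ->]; apply: bigcap_measurableType => i _; exact: mincr.
move=> _ [B mB ->].
pose B' i := if (i < n)%N then B i else C.
pose B'' i := if (i < n)%N then B i else setT.
have mB' i : measurable (B' i) by rewrite /B'; case: ifP.
have mB'' i : measurable (B'' i) by rewrite /B''; case: ifP.
have H' : P (\bigcap_(i in [set: 'I_n.+1]) (increment X (t i) (t i.+1) @^-1` B' i)) =
    (\prod_(i < n.+1) P (increment X (t i) (t i.+1) @^-1` B' i))%E :=
  bm_independent hX t0 tn (fun i => mB' i).
have H'' : P (\bigcap_(i in [set: 'I_n.+1]) (increment X (t i) (t i.+1) @^-1` B'' i)) =
    (\prod_(i < n.+1) P (increment X (t i) (t i.+1) @^-1` B'' i))%E :=
  bm_independent hX t0 tn (fun i => mB'' i).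
rewrite [X in P X = _](_ : _ = \bigcap_(i in [set: 'I_n.+1])
    (increment X (t i) (t i.+1) @^-1` B' i)); last first.
  apply/seteqP; split => [w [wB wC] i _ /=|w h].
    rewrite /B'; case: ifPn => [lt_in|]; first exact: wB.
    rewrite -leqNgt => le_ni.
    suff -> : nat_of_ord i = n by [].
    by apply/eqP; rewrite eqn_leq le_ni -ltnS ltn_ord.
  split; last by have := h ord_max I; rewrite /B'/= ltnn.
  move=> i /= lt_in; have := h (widen_ord (leqnSn n) (Ordinal lt_in)) I.
  by rewrite /B'/= lt_in.
rewrite [X in (P X * _)%E](_ : _ = \bigcap_(i in [set: 'I_n.+1])
    (increment X (t i) (t i.+1) @^-1` B'' i)); last first.
  apply/seteqP; split => [w wB i _ /=|w h].
    by rewrite /B''; case: ifPn => // lt_in; exact: wB.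
  move=> i /= lt_in; have := h (widen_ord (leqnSn n) (Ordinal lt_in)) I.
  by rewrite /B''/= lt_in.
rewrite H' H'' !big_ord_recr/= /B' /B'' ltnn preimage_setT probability_setT mule1.
by congr (_ * _)%E; apply: eq_bigr => i _; rewrite ltn_ord.
Qed.

(** The past is generated by the finite-dimensional events.  Sorting the times
    of such an event produces a grid that ends at s, and the values of the
    process at these times are sums of increments along that grid. *)
Lemma indep_past (s t : R) (A : set T) (C : set R) : 0 <= s -> s <= t ->
  past X s A -> measurable C ->
  P (A `&` increment X s t @^-1` C) =
  (P A * P (increment X s t @^-1` C))%E.
Proof.
move=> s0 st pA mC.
have mX r (B : set R) : measurable B -> measurable (X r @^-1` B).
  by move=> mB; rewrite -[X in measurable X]setTI; exact: measurable_funP.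
pose G := [set A | exists n (r : nat -> R) (B : nat -> set R),
  [/\ forall i, (i < n)%N -> 0 <= r i <= s, forall i, measurable (B i) &
   A = \bigcap_(i in `I_n) (X (r i) @^-1` B i)]].
have {pA} : <<s G >> A.
  apply: smallest_sub pA; first exact: smallest_sigma_algebra.
  move=> _ [r [B [r0 rs mB ->]]]; apply: sub_sigma_algebra.
  exists 1%N, (fun=> r), (fun=> B); split => //; first by move=> i _; rewrite r0.
  by apply/seteqP; split => [w wB i _//|w wB]; exact: (wB 0%N).
apply: indep_pi_lambda => //.
- rewrite -[X in measurable X]setTI.
  by apply: measurable_funB.
- move=> _ _ [n1 [r1 [B1 [r1s mB1 ->]]]] [n2 [r2 [B2 [r2s mB2 ->]]]].
  exists (n1 + n2)%N, (fun i => if (i < n1)%N then r1 i else r2 (i - n1)%N),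
    (fun i => if (i < n1)%N then B1 i else B2 (i - n1)%N); split.
  + move=> i lt_i; case: ltnP => [/r1s//|le_i]; apply: r2s.
    by rewrite ltn_subLR.
  + by move=> i; case: ifP.
  + apply/seteqP; split => [w [w1 w2] i /= lt_i|w h].
      case: ltnP => [/w1//|le_i]; apply: w2 => /=.
      by rewrite ltn_subLR.
    split => i /= lt_i.
      by have := h i; rewrite /= lt_i; apply; exact: ltn_addr.
    have := h (n1 + i)%N; rewrite /= ltn_add2l [(_ < n1)%N]ltnNge leq_addr/= addKn.
    exact.
- move=> _ [n [r [B [_ mB ->]]]]; apply: bigcap_measurableType => i _.
  exact: mX.
move=> {A} _ [n [r [B [rs mB ->]]]].
pose ts := sort <=%R (map r (iota 0 n)).
have sz : size ts = n by rewrite size_sort size_map size_iota.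
(* The grid is 0, the sorted times, s, and then t for ever: the default value
   of nth is the point tau n.+2 that ends the increment from s to t. *)
pose tau i := nth t (0 :: rcons ts s) i.
have ts_s x : x \in ts -> 0 <= x <= s.
  rewrite mem_sort => /mapP[i]; rewrite mem_iota add0n => /rs + ->.
  exact.
have sorted_tau : sorted <=%R (0 :: rcons ts s).
  rewrite /= rcons_path; apply/andP; split.
    rewrite path_min_sorted; first exact: (sort_sorted le_total).
    by apply/allP => x /ts_s/andP[].
  case: (lastP ts) ts_s => [//|l x] H; rewrite last_rcons.
  by have /andP[] : 0 <= x <= s by apply: H; rewrite mem_rcons in_cons eqxx.
have tauS i : (i < n.+2)%N -> tau i <= tau i.+1.
  rewrite ltnS leq_eqVlt => /predU1P[->|lt_i].
    rewrite /tau [X in _ <= X]nth_default/= ?size_rcons ?sz//.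
    by rewrite nth_rcons sz ltnn eqxx.
  have /pathP := sorted_tau; rewrite size_rcons sz.
  move=> /(_ t i lt_i); rewrite /tau.
  by [].
have tau0 : tau 0%N = 0 by [].
have taun : tau n.+1 = s by rewrite /tau/= nth_rcons sz ltnn eqxx.
have taun1 : tau n.+2 = t by rewrite /tau nth_default//= size_rcons sz.
rewrite -taun -taun1; apply: (@indep_grid n.+1 tau) => //.
set GG := [set A | _].
pose T' := g_sigma_algebraType GG.
have Xsum j w : X (tau j) w = \sum_(i < j) (X (tau i.+1) w - X (tau i) w).
  by rewrite -(big_mkord xpredT (fun i => X (tau i.+1) w - X (tau i) w))
     telescope_sumr// tau0 X0 subr0.
have mXtau j : (j <= n.+1)%N -> measurable_fun [set: T'] (X (tau j) : T' -> R).
  move=> jn; apply: (@eq_measurable_fun _ _ T' _ _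
      (fun w : T' => \sum_(i < j) increment X (tau i) (tau i.+1) w)).
    by move=> w _; rewrite Xsum.
  apply: measurable_sum => i _ D mD; rewrite setTI.
  apply: sub_sigma_algebra; exists (fun k => if k == i :> nat then D else setT).
    by move=> k; case: ifP.
  apply/seteqP; split => [w wD k _ /=|w].
    by case: eqP => // ->.
  by move=> /(_ i)/=; rewrite eqxx; apply; rewrite (leq_trans _ jn).
have : forall i, (i < n)%N -> <<s GG >> (X (r i) @^-1` B i).
  move=> i lt_in.
  have rits : r i \in ts by rewrite mem_sort map_f// mem_iota.
  have [j jn ->] : exists2 j, (j <= n.+1)%N & r i = tau j.
    exists (index (r i) ts).+1.
      by rewrite !ltnS -[leqRHS]sz index_size.
    by rewrite /tau/= nth_rcons index_mem rits nth_index.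
  by have := mXtau _ jn measurableT _ (mB i); rewrite setTI.
move=> H; rewrite (_ : \bigcap_(i in _) _ = 
   \bigcap_(i in `I_n) (X (r i) @^-1` B i : set T'))//.
apply: (@bigcap_measurableType _ T').
exact: H.
Qed.

End independence.

(** * Continuous paths, hitting times and stopping times *)

Local Notation cpath f := {within `[0, +oo[, continuous f}.

Section paths.
Context (R : realType).
Implicit Types (f : R -> R) (s t y : R) (a : \bar R).

Lemma cpath_eps f t : cpath f -> 0 <= t -> forall e, 0 < e ->
  exists2 h, 0 < h & forall s, 0 <= s -> `|s - t| < h -> `|f s - f t| < e.
Proof.
move=> /subspace_continuousP cf t0 e e0.
have /cf : `[0, +oo[%classic t by rewrite /= in_itv/= t0.
move=> /cvgrPdist_lt/(_ _ e0); rewrite near_withinE => -[h/= h0 hf].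
exists h => // s s0 st; rewrite distrC; apply: hf.
  by rewrite /ball_/= distrC.
by rewrite /= in_itv/= s0.
Qed.

Lemma cpathS f s t : cpath f -> 0 <= s -> {within `[s, t], continuous f}.
Proof.
move=> cf s0; apply: continuous_subspaceW cf => x/=.
by rewrite !in_itv/= andbT => /andP[+ _]; exact: le_trans.
Qed.

Definition hit_after f a y : \bar R :=
  ereal_inf [set t%:E | t in [set t | (a <= t%:E)%E /\ f t = y]].

Lemma hit_afterE f y : hitting_time f y = hit_after f 0%E y.
Proof.
by rewrite /hitting_time /hit_after; congr (ereal_inf (image _ _)).
Qed.

Lemma hit_after_le f a s y : (a <= s%:E)%E -> f s = y ->
  (hit_after f a y <= s%:E)%E.
Proof. by move=> as_ fs; apply: ereal_inf_lbound; exists s. Qed.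

Lemma le_hit_after f a y : (a <= hit_after f a y)%E.
Proof. by apply: le_ereal_inf_tmp => _ [s [as_ _] <-]. Qed.

(** By compactness, a path that avoids y on a segment stays away from it. *)
Lemma dist_bounded_below f (s t y : R) : cpath f -> 0 <= s -> s <= t ->
  (forall r, s <= r <= t -> f r != y) ->
  exists2 e, 0 < e & forall r, s <= r <= t -> e <= `|f r - y|.
Proof.
move=> cf s0 st fy.
have cg : {within `[s, t], continuous (fun r => `|f r - y|)}.
  move=> x; apply: (@continuous_comp _ _ _ (f : subspace `[s, t] -> R) (fun z => `|z - y|)).
    exact: (cpathS cf s0).
  apply: cvg_norm; apply: cvgB; [exact: cvg_id|exact: cvg_cst].
have [c /[!in_itv]/= cst cmin] := EVT_min st cg.
exists `|f c - y|; first by rewrite normr_gt0 subr_eq0 fy.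
by move=> r rst; apply: cmin; rewrite in_itv.
Qed.

(** The infimum that defines a hitting time is attained when it is finite: a
    path that avoids y between a and t stays at positive distance from y
    there, and by continuity at t also slightly beyond. *)
Lemma hit_after_leP f a t y : cpath f -> (0 <= a)%E ->
  (hit_after f a y <= t%:E)%E <-> exists s, [/\ (a <= s%:E)%E, s <= t & f s = y].
Proof.
move=> cf a0; split; last first.
  move=> [s [as_ st fs]]; apply: (le_trans (hit_after_le as_ fs)).
  by rewrite lee_fin.
move=> ht; apply: contrapT => nex.
have at_ := le_trans (le_hit_after f a y) ht.
have afin : a \is a fin_num.
  by rewrite ge0_fin_numE// (le_lt_trans at_)// ltry.
move: a0 at_ ht nex; rewrite -(fineK afin) !lee_fin; set s := fine a => s0 st ht nex.
have fy r : s <= r <= t -> f r != y.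
  by move=> /andP[sr rt]; apply/eqP => fr; apply: nex; exists r; rewrite lee_fin.
have [e e0 He] := dist_bounded_below cf s0 st fy.
have [h h0 hf] := cpath_eps cf (le_trans s0 st) e0.
suff : ((t + h)%:E <= t%:E)%E by rewrite lee_fin -lerBrDl subrr leNgt h0.
apply: le_trans ht; apply: le_ereal_inf_tmp => _ [r [sr fr] <-].
rewrite lee_fin leNgt; apply/negP => rth.
rewrite lee_fin in sr.
have [rt|tr] := leP r t; first by apply: nex; exists r; rewrite lee_fin.
have := hf r (le_trans s0 sr).
rewrite ger0_norm ?subr_ge0 ?(ltW tr)// ltrBlDl => /(_ rth).
by rewrite fr distrC ltNge He// st lexx.
Qed.

Lemma hit_after_fin f a y : cpath f -> (0 <= a)%E ->
  (hit_after f a y < +oo)%E -> exists s,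
  [/\ hit_after f a y = s%:E, (a <= s%:E)%E & f s = y].
Proof.
move=> cf a0 hoo.
have h0 := le_trans a0 (le_hit_after f a y).
have hfin : hit_after f a y \is a fin_num by rewrite ge0_fin_numE.
have : (hit_after f a y <= (fine (hit_after f a y))%:E)%E by rewrite fineK.
move=> /(hit_after_leP _ _ cf a0)[s [as_ sh fs]].
exists s; split => //; apply/eqP; rewrite eq_le hit_after_le//=.
by rewrite -(fineK hfin) lee_fin.
Qed.

(** Before it hits y, a path stays on its side of y. *)
Lemma lt_hit_after f s t y : cpath f -> 0 <= s -> s <= t ->
  (t%:E < hit_after f s%:E y)%E -> (f s < y -> f t < y) /\ (y < f s -> y < f t).
Proof.
move=> cf s0 st ht.
have H v : Num.min (f s) (f t) <= v <= Num.max (f s) (f t) -> v = y -> False.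
  move=> /(IVT st (cpathS cf s0))[c /[!in_itv]/= /andP[sc ct] fc] vy.
  move: ht; rewrite ltNge => /negP; apply.
  apply: (@le_trans _ _ c%:E); last by rewrite lee_fin.
  by apply: hit_after_le; rewrite ?lee_fin// fc.
split => fsy; rewrite ltNge; apply/negP => fty; apply: (H y) => //.
  by rewrite ge_min (ltW fsy)/= le_max fty orbT.
by rewrite ge_min fty orbT/= le_max (ltW fsy).
Qed.

(** The numbers frac i j form a countable dense set of fractions of the unit
    interval.  Times of the form t * frac i j stay below t, hence they can be
    used to write an event of the past of t as a countable combination. *)
Definition frac (i j : nat) : R := Num.min 1 (i%:R / j.+1%:R).

Lemma frac_ge0 i j : 0 <= frac i j.
Proof. by rewrite le_min ler01 divr_ge0. Qed.

Lemma frac_le1 i j : frac i j <= 1.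
Proof. by rewrite ge_min lexx. Qed.

Lemma frac_bounds s t e : 0 <= s -> s <= t -> 0 < e ->
  exists i j, [/\ s - e < t * frac i j, t * frac i j <= s, s <= t * frac i.+1 j &
    t * frac i.+1 j < s + e].
Proof.
move=> s0 st e0; have [t0|t_neq0] := eqVneq t 0.
  have se0 : s = 0 by apply/eqP; rewrite eq_le s0 -t0 st.
  exists 0%N, 0%N; rewrite t0 se0 !mul0r sub0r add0r; split => //.
  by rewrite oppr_lt0.
have t0 : 0 < t by rewrite lt_neqAle eq_sym t_neq0 (le_trans s0 st).
pose j := Num.truncn (t / e); pose i := Num.truncn (s / t * j.+1%:R).
have j0 : 0 < j.+1%:R :> R by [].
have tj : t / j.+1%:R < e.
  rewrite ltr_pdivrMr// mulrC -ltr_pdivrMr//; exact: truncnS_gt.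
have st0 : 0 <= s / t * j.+1%:R by rewrite !mulr_ge0// invr_ge0 ltW.
have il : t * (i%:R / j.+1%:R) <= s.
  have := truncn_le (s / t * j.+1%:R); rewrite st0 => il.
  rewrite mulrA ler_pdivrMr// mulrC -ler_pdivlMr//.
  by rewrite mulrAC.
have iu : s < t * (i.+1%:R / j.+1%:R).
  have := truncnS_gt (s / t * j.+1%:R) => iu.
  rewrite mulrA ltr_pdivlMr// [X in _ < X]mulrC -ltr_pdivrMr//.
  by rewrite mulrAC.
have iD : t * (i.+1%:R / j.+1%:R) = t * (i%:R / j.+1%:R) + t / j.+1%:R.
  by rewrite -natr1 mulrDl mul1r mulrDr.
have i1 : i%:R / j.+1%:R <= 1 :> R.
  by rewrite -(ler_pM2l t0) mulr1 (le_trans il).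
exists i, j; rewrite /frac (min_r i1); split => //.
- by rewrite ltrBlDr (lt_le_trans iu)// iD lerD2l ltW.
- by rewrite minEle; case: ifP => _; rewrite ?mulr1// ltW.
- have : t * (i.+1%:R / j.+1%:R) < s + e by rewrite iD ler_ltD.
  apply: le_lt_trans; rewrite ler_pM2l//.
  by rewrite ge_min lexx orbT.
Qed.

End paths.

Section stopping_times.
Context d (T : measurableType d) (R : realType) (X : R -> T -> R).
Hypothesis cX : forall w, cpath (X ^~ w).
Implicit Types (s t : T -> \bar R).

(** Random times with values in [0, +oo] adapted to the natural filtration;
    the value +oo encodes that the time never comes. *)
Definition stopping s := (forall w, (0 <= s w)%E) /\
  forall t : R, 0 <= t -> past X t [set w | (s w <= t%:E)%E].

Lemma stopping_past s (r t : R) : stopping s -> 0 <= r -> r <= t ->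
  past X t [set w | (s w <= r%:E)%E].
Proof. by move=> [_ ps] r0 rt; apply: past_le rt _ _; exact: ps. Qed.

Lemma stopping_gt s (r t : R) : stopping s -> 0 <= r -> r <= t ->
  past X t [set w | (r%:E < s w)%E].
Proof.
move=> ss r0 rt; rewrite [X in past _ _ X](_ : _ = ~` [set w | (s w <= r%:E)%E]).
  by apply: pastC; exact: stopping_past.
by apply/seteqP; split => w /=; rewrite ltNge => /negP.
Qed.

Lemma stopping0 : stopping (cst 0%E).
Proof.
split => // t t0; rewrite [X in past _ _ X](_ : _ = setT); first exact: pastT.
by apply/seteqP; split => // w _ /=; rewrite lee_fin.
Qed.

Lemma stopping_min s t : stopping s -> stopping t ->
  stopping (fun w => Order.min (s w) (t w)).
Proof.
move=> ss st; split => [w|r r0]; first by rewrite le_min (ss.1 w) (st.1 w).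
rewrite [X in past _ _ X](_ : _ =
  [set w | (s w <= r%:E)%E] `|` [set w | (t w <= r%:E)%E]).
  by apply: pastU; exact: stopping_past.
by apply/seteqP; split => w /=; rewrite ge_min => /orP.
Qed.

(** Both s <= r and s < t hold exactly when s <= q < t for some q <= r in the
    countable dense set. *)
Lemma stopping_before s t : stopping s -> stopping t ->
  stopping (fun w => if (s w < t w)%E then s w else +oo%E).
Proof.
move=> ss st; split => [w|r r0].
  by case: ifP => _; [exact: ss.1|exact: leey].
rewrite [X in past _ _ X](_ : _ = \bigcup_i \bigcup_j
  ([set w | (s w <= (r * frac R i j)%:E)%E] `&`
   [set w | ((r * frac R i j)%:E < t w)%E])).
  apply: past_bigcup => i; apply: past_bigcup => j.
  have r0' : 0 <= r * frac R i j by rewrite mulr_ge0 ?frac_ge0.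
  have r1 : r * frac R i j <= r by rewrite ler_piMr ?frac_le1.
  by apply: pastI; [exact: stopping_past|exact: stopping_gt].
apply/seteqP; split => w /=.
  case: ifPn => [stw|_]; last by rewrite leye_eq.
  move=> swr.
  have sfin : s w \is a fin_num by rewrite ge0_fin_numE ?ss.1// (le_lt_trans swr)// ltry.
  move: (ss.1 w) swr stw; rewrite -(fineK sfin) !lee_fin; set x := fine _ => x0 xr xt.
  have [e e0 xe] : exists2 e, 0 < e & ((x + e)%:E <= t w)%E.
    case: (t w) xt => [y| |]//; first by rewrite lte_fin => xy; exists (y - x);
      [rewrite subr_gt0|rewrite addrC subrK].
    by exists 1 => //; exact: leey.
  have [i [j [_ _ sl su]]] := frac_bounds x0 xr e0.
  exists i.+1 => //; exists j => //=; split.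
    by rewrite -(fineK sfin) lee_fin.
  by apply: lt_le_trans xe; rewrite lte_fin.
move=> [i _ [j _ /= [sl tl]]]; rewrite (le_lt_trans sl tl) (le_trans sl)//.
by rewrite lee_fin ler_piMr ?frac_le1.
Qed.

(** The level y is hit between s and t exactly when, for each n, the path is
    within 1 / n of y at a time t * frac i j which is at least s.  If the path
    were at y at the time s itself such times could fail to exist, since s is
    arbitrary: hence the condition on X at s, unless s = 0 = t * frac 0 0. *)
Lemma stopping_hit_after s (y : R) : stopping s ->
  (forall w (r : R), s w = r%:E -> r = 0 \/ X r w != y) ->
  stopping (fun w => hit_after (X ^~ w) (s w) y).
Proof.
move=> ss sy; split => [w|t t0].
  exact: le_trans (ss.1 w) (le_hit_after _ _ _).
rewrite [X in past _ _ X](_ : _ = \bigcap_n \bigcup_i \bigcup_j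
  ([set w | (s w <= (t * frac R i j)%:E)%E] `&`
   X (t * frac R i j) @^-1` [set z | `|z - y| < n.+1%:R^-1])).
  apply: past_bigcap => n; apply: past_bigcup => i; apply: past_bigcup => j.
  have r0 : 0 <= t * frac R i j by rewrite mulr_ge0 ?frac_ge0.
  have r1 : t * frac R i j <= t by rewrite ler_piMr ?frac_le1.
  apply: pastI; first exact: stopping_past.
  apply: past_preimage => //.
  rewrite (_ : [set z | _] = `]y - n.+1%:R^-1, y + n.+1%:R^-1[%classic)//.
  by apply/seteqP; split => z /=; rewrite in_itv/= ltr_distl.
apply/seteqP; split => w /=.
  move=> /(hit_after_leP _ _ (@cX w) (ss.1 w))[r [sr rt Xr]] n _.
  have sfin : s w \is a fin_num by rewrite ge0_fin_numE ?ss.1// (le_lt_trans sr)// ltry.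
  have [E|/eqP sneq] := pselect (s w = r%:E).
    have [r0|] := sy _ _ E; last by rewrite Xr eqxx.
    exists 0%N => //; exists 0%N => //=.
    have -> : t * frac R 0 0 = r by rewrite /frac mul0r min_r ?mulr0.
    by rewrite E Xr subrr normr0.
  have sr' : fine (s w) < r.
    by rewrite -lte_fin fineK// lt_neqAle sneq.
  have s0 : 0 <= fine (s w) by rewrite fine_ge0 ?ss.1.
  have r0 := le_trans s0 (ltW sr').
  have n0 : 0 < n.+1%:R^-1 :> R by rewrite invr_gt0.
  have [h h0 Xh] := cpath_eps (@cX w) r0 n0.
  have e0 : 0 < Num.min h (r - fine (s w)) by rewrite lt_min h0 subr_gt0.
  have [i [j [rl ru _ _]]] := frac_bounds r0 rt e0.
  exists i => //; exists j => //=; split.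
    rewrite -(fineK sfin) lee_fin ltW// (le_lt_trans _ rl)//.
    by rewrite lerBrDl -lerBrDr ge_min lexx orbT.
  rewrite -Xr; apply: Xh; first by rewrite mulr_ge0 ?frac_ge0.
  rewrite ler0_norm ?subr_le0// opprB ltrBlDl -ltrBlDr (le_lt_trans _ rl)//.
  by rewrite lerD2l lerN2 ge_min lexx.
move=> H; apply/(hit_after_leP _ _ (@cX w) (ss.1 w)); apply: contrapT => nex.
have st : (s w <= t%:E)%E.
  have [i _ [j _ /= [sl _]]] := H 0%N I.
  by apply: (le_trans sl); rewrite lee_fin ler_piMr ?frac_le1.
have sfin : s w \is a fin_num by rewrite ge0_fin_numE ?ss.1// (le_lt_trans st)// ltry.
have s0 : 0 <= fine (s w) by rewrite fine_ge0 ?ss.1.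
have sft : fine (s w) <= t by rewrite -lee_fin fineK.
have Xy r : fine (s w) <= r <= t -> X r w != y.
  move=> /andP[sr rt]; apply/eqP => Xr; apply: nex; exists r.
  by rewrite -(fineK sfin) lee_fin.
have [e e0 He] := dist_bounded_below (@cX w) s0 sft Xy.
have [i _ [j _ /= [sl]]] := H (Num.truncn e^-1) I.
apply/negP; rewrite -leNgt.
apply: (@le_trans _ _ e); last first.
  apply: He; rewrite ler_piMr ?frac_le1// andbT.
  by rewrite -lee_fin fineK.
by rewrite invf_ple ?posrE// ltW// truncnS_gt.
Qed.

End stopping_times.

(** * One step of the exponential martingale *)

Section exponential_step.
Context d (T : measurableType d) (R : realType) (P : probability T R).
Variables (mu : R) (X : R -> {RV P >-> R}).
Hypotheses (hX : brownian_motion mu 0 X) (X0 : forall w, X 0 w = 0).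

Let mX (t : R) : measurable_fun setT (X t). Proof. exact: measurable_funP. Qed.

(** exp(l X_t - t * mgf_rate mu l) is a martingale. *)
Definition mgf_rate (m l : R) := l * m + l ^+ 2 / 2.

Lemma measurable_expRl (l : R) : measurable_fun [set: R] (fun x : R => expR (l * x)).
Proof. by apply: measurableT_comp => //; exact: mulrl_measurable. Qed.

Lemma increment_mgf (s t l : R) : 0 <= s -> s < t ->
  (\int[P]_w (expR (l * increment X s t w))%:E =
   (expR (mgf_rate mu l * (t - s)))%:E)%E.
Proof.
move=> s0 st.
have mI : measurable_fun setT (increment X s t : T -> measurableTypeR R).
  exact: measurable_funB.
pose I : {mfun T >-> measurableTypeR R} := HB.pack (increment X s t)
  (isMeasurableFun.Build _ _ _ _ _ mI).
pose f (x : measurableTypeR R) := (expR (l * x))%:E.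
have mf : measurable_fun setT f by apply/measurable_EFinP; exact: measurable_expRl.
transitivity (\int[distribution P I]_x f x)%E.
  rewrite ge0_integral_pushforward//= => x _.
  by rewrite lee_fin expR_ge0.
transitivity (\int[normal_prob (mu * (t - s)) (Num.sqrt (t - s))]_x f x)%E.
  by apply: eq_measure_integral => A mA _; exact: (bm_increment hX).
rewrite normal_mgf; last by rewrite sqrtr_eq0 -ltNge subr_gt0.
rewrite sqr_sqrtr; last by rewrite subr_ge0 ltW.
by congr (expR _)%:E; rewrite /mgf_rate; field.
Qed.

(** One step of the exponential martingale on an event A of the past of s:
    exp(l X_t) is exp(l X_s), restricted to A, times a factor independent of
    both. *)
Lemma exp_step (s t l : R) (A : set T) : 0 <= s -> s < t -> past X s A ->
  (\int[P]_w (\1_A w * expR (l * X t w))%:E =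
   (expR (mgf_rate mu l * (t - s)))%:E * \int[P]_w (\1_A w * expR (l * X s w))%:E)%E.
Proof.
move=> s0 st pA.
have mA : measurable A by apply: past_measurable pA; exact: mX.
have mU : measurable_fun setT (fun w => \1_A w * expR (l * X s w)).
  apply: measurable_funM; first exact: measurable_indic.
  by apply: measurableT_comp (measurable_expRl l) _.
have mI : measurable_fun setT (increment X s t) by exact: measurable_funB.
have mV : measurable_fun setT (fun w => expR (l * increment X s t w)).
  exact: measurableT_comp (measurable_expRl l) mI.
pose U : {mfun T >-> R} := HB.pack (fun w => \1_A w * expR (l * X s w))
  (isMeasurableFun.Build _ _ _ _ _ mU).
pose V : {mfun T >-> R} := HB.pack (fun w => expR (l * increment X s t w))
  (isMeasurableFun.Build _ _ _ _ _ mV).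
rewrite -(increment_mgf l s0 st) muleC.
rewrite -[RHS](@ge0_integral_indep _ _ _ P U V); last 3 first.
- by move=> w; rewrite /U/= mulr_ge0 ?expR_ge0// indicE.
- by move=> w; rewrite /V/= expR_ge0.
- move=> B1 B2 mB1 mB2.
  have mB l' (B : set R) : measurable B -> measurable ((fun x : R => expR (l' * x)) @^-1` B).
    by move=> mB; rewrite -[X in measurable X]setTI; exact: measurable_expRl.
  rewrite (_ : V @^-1` B2 = increment X s t @^-1` ((fun x : R => expR (l * x)) @^-1` B2))//.
  apply: (indep_past hX X0 s0 (ltW st) _ (mB _ _ mB2)).
  rewrite (_ : U @^-1` B1 = (A `&` X s @^-1` ((fun x : R => expR (l * x)) @^-1` B1)) `|`
      (~` A `&` [set w | B1 0])); last first.
    apply/seteqP; split => w; rewrite /U/= indicE.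
      have [wA|wA] := boolP (w \in A).
        by rewrite mul1r => ?; left; split => //; exact: set_mem.
      rewrite mul0r => ?; right; split => //.
      by move=> /mem_set; exact/negP.
    move=> [[/mem_set -> h]|[wA h]]; first by rewrite mul1r.
    by rewrite memNset// mul0r.
  apply: pastU; apply: pastI => //.
  + by apply: past_preimage => //; exact: mB.
  + exact: pastC.
  + have [B10|B10] := pselect (B1 0).
      rewrite (_ : [set _ | _] = setT); first exact: pastT.
      by apply/seteqP; split.
    rewrite (_ : [set _ | _] = set0); first exact: sigma_algebra0.
    by apply/seteqP; split.
apply: eq_integral => w _; rewrite /U/V/= -mulrA -expRD; congr ((_ * expR _)%:E).
by rewrite /increment; ring.
Qed.

(** The density of X_t is at most of order 1 / sqrt t, so the probability to
    lie in a fixed bounded interval at time t tends to 0. *)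
Lemma escape_null (S : set T) (b c t0 : R) : measurable S -> b <= c ->
  (forall w t, S w -> t0 <= t -> b <= X t w <= c) -> P S = 0%E.
Proof.
move=> mS bc HS.
apply/eqP; rewrite eq_le measure_ge0 andbT.
apply/lee_addgt0Pr => e e0; rewrite add0e.
(* At this time the bound (c - b) / sqrt t is at most e. *)
pose t := Num.max t0 (Num.max 1 ((c - b) / e) ^+ 2).
have t1 : 1 <= t.
  rewrite le_max; apply/orP; right.
  by rewrite -[X in X <= _](expr1n _ 2) ler_sqr ?nnegrE// le_max ?lexx ?ler01.
have t00 : 0 < t by rewrite (lt_le_trans ltr01).
apply: (@le_trans _ _ (P (increment X 0 t @^-1` `[b, c]%classic))).
  apply: le_measure; rewrite ?inE//.
    by rewrite -[X in measurable X]setTI; apply: measurable_funB.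
  move=> w Sw; rewrite /= /increment X0 subr0 in_itv/=.
  by apply: HS => //; rewrite le_max lexx.
rewrite (bm_increment hX (lexx 0) t00)// subr0.
have st0 : 0 < Num.sqrt t by rewrite sqrtr_gt0.
apply: le_trans (normal_prob_itv_le _ _ bc) _; first by rewrite gt_eqF.
rewrite lee_fin /normal_peak sqr_sqrtr ?(ltW t00)//.
have cbs : c - b <= e * Num.sqrt t.
  rewrite mulrC -ler_pdivrMr//.
  apply: (@le_trans _ _ (Num.max 1 ((c - b) / e))); first by rewrite le_max lexx orbT.
  rewrite -[leLHS]ger0_norm ?le_max ?ler01//.
  by rewrite -sqrtr_sqr ler_sqrt ?(ltW t00)// le_max lexx orbT.
have ts : Num.sqrt t <= Num.sqrt (t * pi *+ 2).
  rewrite ler_sqrt; last by rewrite mulrn_wge0// mulr_ge0 ?pi_ge0// ltW.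
  rewrite -mulr_natr -mulrA ler_peMr ?(ltW t00)//.
  by have := pi_ge2 R; lra.
rewrite mulrC ler_pdivrMr; last exact: lt_le_trans ts.
by apply: le_trans cbs _; rewrite ler_wpM2l// ltW.
Qed.

(** The truncation to a neighbourhood of the interval from b to c of radius 1:
    the margin 1 is what makes truncation errors exponentially rare. *)
Definition clamp (b c x : R) := Num.max (b - 1) (Num.min (c + 1) x).

Lemma clamp_id (b c x : R) : b - 1 <= x <= c + 1 -> clamp b c x = x.
Proof. by move=> /andP[bx xc]; rewrite /clamp min_r// max_r. Qed.

Lemma clamp_norm (b c x : R) : b <= c -> `|clamp b c x| <= `|b| + `|c| + 1.
Proof.
move=> bc; rewrite /clamp ler_norml.
have := ler_norm b; have := ler_norm c; have := ler_norm (- b).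
have := ler_norm (- c); have := normr_ge0 b; have := normr_ge0 c.
rewrite !normrN maxEle minEle; move: (`|b|) (`|c|) => b' c'.
by case: ifP; case: ifP; lra.
Qed.

Lemma continuous_clamp (b c : R) : continuous (clamp b c).
Proof.
move=> x; apply/cvgrPdist_lt => e e0; near=> y.
apply: (@le_lt_trans _ _ `|x - y|); last first.
  by near: y; exact: cvgr_dist_lt.
rewrite /clamp !maxEle !minEle ler_norml.
have := ler_norm (x - y); have := ler_norm (- (x - y)); rewrite normrN.
by do ! case: ifP; lra.
Unshelve. all: by end_near. Qed.

(** Truncation has an effect only if the increment z exceeds 1, where
    exp(|l| |z|) <= exp(- K) exp((|l| + K) |z|) for any K: the parameter K buys
    a factor exp(- K) in exchange for a larger exponent, and it will grow with
    the number of grid points. *)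
Lemma clamp_error (b c l K x z : R) : b <= x <= c -> 0 <= K ->
  `|expR (l * (x + z)) - expR (l * clamp b c (x + z))| <=
  expR (`|l| * (`|b| + `|c| + 1) - K) *
    (expR ((`|l| + K) * z) + expR (- (`|l| + K) * z)).
Proof.
move=> /andP[bx xc] K0.
have bc := le_trans bx xc.
have [z1|z1] := leP `|z| 1.
  rewrite clamp_id; last by move: z1; rewrite ler_norml; lra.
  by rewrite subrr normr0 mulr_ge0 ?addr_ge0 ?expR_ge0.
set M := `|b| + `|c| + 1.
have xM : `|x| <= M.
  rewrite /M ler_norml.
  have := ler_norm b; have := ler_norm c; have := ler_norm (- b).
  have := ler_norm (- c); have := normr_ge0 b; have := normr_ge0 c.
  by rewrite !normrN; move: (`|b|) (`|c|) => b' c'; lra.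
have e1 : expR (l * (x + z)) <= expR (`|l| * (M + `|z|)).
  rewrite ler_expR (le_trans (ler_norm _))// normrM ler_wpM2l//.
  by rewrite (le_trans (ler_normD _ _))// lerD2r.
have e2 : expR (l * clamp b c (x + z)) <= expR (`|l| * (M + `|z|)).
  rewrite ler_expR (le_trans (ler_norm _))// normrM ler_wpM2l//.
  by rewrite (le_trans (clamp_norm _ bc))// lerDl.
have e3 : expR (`|l| * (M + `|z|)) <=
    expR (`|l| * M - K) * expR ((`|l| + K) * `|z|).
  rewrite -expRD ler_expR.
  have : K * 1 <= K * `|z| by rewrite ler_wpM2l// ltW.
  by rewrite mulrDr mulrDl; lra.
have e4 : expR ((`|l| + K) * `|z|) <=
    expR ((`|l| + K) * z) + expR (- (`|l| + K) * z).
  have [z0|z0] := leP 0 z; first by rewrite (ger0_norm z0) lerDl expR_ge0.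
  by rewrite (ltr0_norm z0) mulrN mulNr lerDr expR_ge0.
apply: (@le_trans _ _ (expR (`|l| * (M + `|z|)))).
  have := expR_ge0 (l * (x + z)); have := expR_ge0 (l * clamp b c (x + z)).
  by rewrite ler_norml; move: e1 e2; lra.
by apply: (le_trans e3); rewrite ler_wpM2l ?expR_ge0.
Qed.

End exponential_step.

(** * Optional stopping along grids *)

Section bounded_Rintegral.
Context d (T : measurableType d) (R : realType) (P : probability T R).

Lemma bounded_integrable (f : T -> R) (M : R) : measurable_fun setT f ->
  (forall w, `|f w| <= M) -> P.-integrable setT (EFin \o f).
Proof.
move=> mf fM; apply: measurable_bounded_integrable => //.
  by rewrite (le_lt_trans (probability_le1 P measurableT))// ltry.
exists M; split; first exact: num_real.
by move=> x Mx w _ /=; rewrite (le_trans (fM w))// ltW.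
Qed.

Lemma integral_sum_integrable (f : nat -> T -> R) (N : nat) :
  (forall k, P.-integrable setT (EFin \o f k)) ->
  P.-integrable setT (EFin \o (fun w => \sum_(k < N) f k w)) /\
  \int[P]_w (\sum_(k < N) f k w) = \sum_(k < N) \int[P]_w f k w.
Proof.
move=> fi; elim: N => [|N [IHi IH]].
  rewrite big_ord0; split.
    rewrite [X in P.-integrable _ X](_ : _ = cst 0%E); first exact: integrable0.
    by apply/funext => w /=; rewrite big_ord0.
  by under eq_Rintegral => w _ do rewrite big_ord0; rewrite Rintegral_cst// mul0r.
have E : (fun w => \sum_(k < N.+1) f k w) = (fun w => \sum_(k < N) f k w + f N w).
  by apply/funext => w; rewrite big_ord_recr.
split.
  rewrite E [X in P.-integrable _ X](_ : _ =
    (EFin \o (fun w => \sum_(k < N) f k w)) \+ (EFin \o f N))//.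
  exact: integrableD.
by rewrite big_ord_recr/= -IH -RintegralD// -E.
Qed.

Lemma ge0_integral_le_add (f g e : T -> R) :
  measurable_fun setT f -> measurable_fun setT g -> measurable_fun setT e ->
  (forall w, 0 <= f w) -> (forall w, 0 <= g w) -> (forall w, 0 <= e w) ->
  (forall w, f w <= g w + e w) ->
  (\int[P]_w (f w)%:E <= \int[P]_w (g w)%:E + \int[P]_w (e w)%:E)%E.
Proof.
move=> /measurable_EFinP mf /measurable_EFinP mg /measurable_EFinP me f0 g0 e0 fge.
rewrite -ge0_integralD//; last 2 first.
- by move=> w _; rewrite lee_fin.
- by move=> w _; rewrite lee_fin.
apply: ge0_le_integral => //.
- by move=> w _; rewrite lee_fin.
- exact: emeasurable_funD.
- by move=> w _; rewrite -EFinD lee_fin.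
Qed.

End bounded_Rintegral.

Section grid_sums.
Context (R : realType).

(** Summing the increments of g along the grid of mesh h as long as the left
    endpoint is before r telescopes to the increment of g from 0 to r rounded
    up to the grid (or to the last grid point if r is beyond it). *)
Definition grid_sum (g : R -> R) (r : \bar R) (h : R) (N : nat) : R :=
  \sum_(k < N) (if ((k%:R * h)%:E < r)%E then g (k.+1%:R * h) - g (k%:R * h) else 0).

Lemma grid_sumE g r h N : 0 <= h -> exists j,
  [/\ (j <= N)%N, grid_sum g r h N = g (j%:R * h) - g 0,
      forall k, (k < j)%N -> ((k%:R * h)%:E < r)%E
    & (j < N)%N -> (r <= (j%:R * h)%:E)%E].
Proof.
move=> h0; elim: N => [|N [j [jN sE jlt jge]]].
  by exists 0%N; split => //; rewrite /grid_sum big_ord0 mul0r subrr.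
rewrite /grid_sum big_ord_recr/= -/(grid_sum g r h N) sE.
move: jN; rewrite leq_eqVlt => /predU1P[jN|ltjN].
  rewrite jN in jlt *; case: ltP => [Nr|rN].
    exists N.+1; split => //.
    - by rewrite addrC addrA subrK.
    - by move=> k; rewrite ltnS leq_eqVlt => /predU1P[->//|]; exact: jlt.
    - by rewrite ltnn.
  by exists N; split; rewrite ?addr0.
have rj := jge ltjN.
exists j; split => //; first by rewrite ltnW// ltnW.
rewrite ltNge (le_trans rj) ?addr0//.
by rewrite lee_fin ler_wpM2r// ler_nat ltnW.
Qed.

(** With mesh 1 / m^2 and m^3 steps, the grid becomes fine and its horizon m
    tends to infinity. *)
Lemma grid_sum_cvg (g : R -> R) (r : R) : cpath g -> 0 <= r ->
  grid_sum g r%:E (n.+1%:R ^- 2) (n.+1 ^ 3)%N @[n --> \oo] --> g r - g 0.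
Proof.
move=> cg r0; apply/cvgrPdist_lt => e e0.
have [h h0 gh] := cpath_eps cg r0 e0.
near=> n.
set m : R := n.+1%:R; set k := m ^- 2.
have m0 : 0 < m by rewrite ltr0n.
have m1 : 1 <= m by rewrite ler1n.
have k0 : 0 < k by rewrite invr_gt0 exprn_gt0.
have k1 : k <= 1 by rewrite invf_le1 ?exprn_ege1// exprn_gt0.
have kh : k < h.
  apply: (@le_lt_trans _ _ m^-1).
    by rewrite lef_pV2 ?posrE ?exprn_gt0// expr2 ler_peMr// ltW.
  by rewrite /m; near: n; exact: (@near_infty_natSinv_lt R (PosNum h0)).
have mr : r + 1 <= m.
  by rewrite /m -natr1 lerD2r; near: n; exact: nbhs_infty_ger.
have Nk : (n.+1 ^ 3)%N%:R * k = m.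
  by rewrite natrX -/m /k exprSr mulrC mulrA mulVf ?mul1r// expf_neq0// gt_eqF.
have [j [jN -> jlt jge]] := grid_sumE g r%:E (n.+1 ^ 3)%N (ltW k0).
rewrite opprB addrA subrK distrC; apply: gh; first by rewrite mulr_ge0// ltW.
have jk : j%:R * k < r + k.
  case: j {jN jge} jlt => [_|j jlt]; first by rewrite mul0r ltr_wpDl.
  have := jlt j (ltnSn _); rewrite lte_fin => jr.
  by rewrite -natr1 mulrDl mul1r ltrD2r.
have rj : r <= j%:R * k.
  move: jN; rewrite leq_eqVlt => /predU1P[jE|/jge]; last by rewrite lee_fin.
  by move: jk; rewrite jE Nk; lra.
rewrite ger0_norm ?subr_ge0//.
by rewrite ltrBlDl (lt_trans jk)// ltrD2l.
Unshelve. all: by end_near. Qed.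

(** The truncation errors of the m^3 steps with K = m add up to O(1 / m): each
    is O(exp(- m)), as the exponent |l| + m is of order m while the variance of
    one step is 1 / m^2. *)
Lemma grid_error_small (mu l M0 : R) (n : nat) :
  (n.+1 ^ 3)%N%:R * (expR (M0 - n.+1%:R) *
    (expR (mgf_rate mu (`|l| + n.+1%:R) * n.+1%:R ^- 2) +
     expR (mgf_rate mu (- (`|l| + n.+1%:R)) * n.+1%:R ^- 2))) <=
  48 * expR (M0 + ((`|l| + 1) * `|mu| + (`|l| + 1) ^+ 2 / 2)) / n.+1%:R.
Proof.
set K : R := n.+1%:R; set D := _ + _ / 2.
have K0 : 0 < K by rewrite ltr0n.
have K1 : 1 <= K by rewrite ler1n.
set p := `|l| + K.
have p0 : 0 <= p by rewrite addr_ge0// ltW.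
have pK : p <= (`|l| + 1) * K.
  by rewrite mulrDl mul1r lerD2r ler_peMr.
have gp q : `|q| = p -> expR (mgf_rate mu q / K ^+ 2) <= expR D.
  move=> qp; rewrite ler_expR ler_pdivrMr ?exprn_gt0// /mgf_rate /D mulrDl lerD//.
    rewrite (le_trans (ler_norm _))// normrM qp.
    apply: (@le_trans _ _ ((`|l| + 1) * K * `|mu|)); first exact: ler_wpM2r.
    rewrite mulrAC ler_wpM2l ?mulr_ge0 ?addr_ge0// expr2.
    by rewrite ler_peMr// ltW.
  rewrite [leRHS]mulrAC ler_wpM2r ?invr_ge0// -real_normK ?num_real// qp -exprMn.
  by rewrite ler_sqr ?nnegrE// mulr_ge0 ?addr_ge0// ltW.
(* One term of the exponential series beats the m^3 steps by a factor m. *)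
have e4 : K ^+ 4 / 24 <= expR K.
  have := expR_ge1Dxn 3 (ltW K0); rewrite (_ : 4`! = 24)%N//.
  by apply: le_trans; rewrite lerDr ler01.
have eK : K ^+ 3 * expR (- K) <= 24 / K.
  rewrite expRN ler_pdivrMr ?expR_gt0// mulrAC ler_pdivlMr// -exprSr.
  by move: e4; lra.
have s2 : expR (mgf_rate mu p / K ^+ 2) + expR (mgf_rate mu (- p) / K ^+ 2) <= 2 * expR D.
  by rewrite mulr_natl mulr2n lerD// gp// ?normrN ger0_norm.
rewrite natrX -/K expRD.
apply: (@le_trans _ _ (K ^+ 3 * (expR M0 * expR (- K) * (2 * expR D)))).
  by rewrite ler_wpM2l ?(exprn_ge0 _ (ltW K0))// ler_wpM2l.
rewrite expRD.
have -> : K ^+ 3 * (expR M0 * expR (- K) * (2 * expR D)) =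
  K ^+ 3 * expR (- K) * (2 * (expR M0 * expR D)) by ring.
have -> : 48 * (expR M0 * expR D) / K = 24 / K * (2 * (expR M0 * expR D)) by ring.
by rewrite ler_wpM2r// !mulr_ge0 ?expR_ge0.
Qed.

End grid_sums.

Section optional_stopping.
Context d (T : measurableType d) (R : realType) (P : probability T R).
Variables (mu : R) (X : R -> {RV P >-> R}).
Hypotheses (hX : brownian_motion mu 0 X) (X0 : forall w, X 0 w = 0).
Variables (s t : T -> \bar R) (b c l : R).
Hypotheses (ss : stopping X s) (st : stopping X t).
Hypothesis (s_le_t : forall w, (s w <= t w)%E).
Hypothesis (bc : b <= c).
Hypothesis Xbc : forall w (r : R),
  (s w <= r%:E)%E -> (r%:E <= t w)%E -> b <= X r w <= c.

Let mX (r : R) : measurable_fun setT (X r). Proof. exact: measurable_funP. Qed.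

Let cX (w : T) : cpath (fun t => X t w). Proof. exact: bm_continuous hX w. Qed.

(** A bounded substitute for exp(l X), equal to it between the two times. *)
Let phi (r : R) (w : T) : R := expR (l * clamp b c (X r w)).

Let M := expR (`|l| * (`|b| + `|c| + 1)).

Let phi_le r w : `|phi r w| <= M.
Proof.
rewrite ger0_norm ?expR_ge0// ler_expR (le_trans (ler_norm _))// normrM.
by rewrite ler_wpM2l// clamp_norm.
Qed.

Let mphi r : measurable_fun setT (phi r).
Proof.
apply: measurableT_comp (measurable_expRl l) _.
by apply: measurable_maxr => //; apply: measurable_minr.
Qed.

Let cphi w : cpath (fun r => phi r w).
Proof.
move=> x; apply: (@continuous_comp _ _ _ ((fun t => X t w) : subspace `[0, +oo[ -> R)
  (fun y => expR (l * clamp b c y))); first exact: cX.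
apply: continuous_comp; last exact: continuous_expR.
apply: continuous_comp; last exact: mulrl_continuous.
exact: continuous_clamp.
Qed.

Let h (n : nat) : R := n.+1%:R ^- 2.
Let N (n : nat) : nat := (n.+1 ^ 3)%N.

(** The event that the k-th step of the grid starts between the two times; it
    belongs to the past of the starting point of that step. *)
Let alive (n k : nat) : set T :=
  [set w | (s w <= (k%:R * h n)%:E)%E] `&` [set w | ((k%:R * h n)%:E < t w)%E].

Let gain (n k : nat) (w : T) : R :=
  \1_(alive n k) w * phi (k.+1%:R * h n) w - \1_(alive n k) w * phi (k%:R * h n) w.

Let total (n : nat) (w : T) : R := \sum_(k < N n) gain n k w.

Let h_ge0 n : 0 <= h n.
Proof. by rewrite invr_ge0 exprn_ge0. Qed.

(** The indicator of s <= r < t is the difference of those of r < t and of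
    r < s, so the total gain is a difference of two telescoping sums. *)
Let totalE n w : total n w =
  grid_sum (phi^~ w) (t w) (h n) (N n) - grid_sum (phi^~ w) (s w) (h n) (N n).
Proof.
rewrite /total /grid_sum -sumrB; apply: eq_bigr => k _.
rewrite /gain -mulrBr indicE.
have [sk|ks] := leP (s w) (k%:R * h n)%:E.
  rewrite subr0; case: ifPn => kt.
    by rewrite mem_set ?mul1r//; split.
  rewrite memNset ?mul0r// => -[_ /=].
  exact/negP.
rewrite (lt_le_trans ks (s_le_t w)) subrr memNset ?mul0r// => -[/= + _].
by apply/negP; rewrite -ltNge.
Qed.

Let total_le n w : `|total n w| <= M *+ 2.
Proof.
rewrite totalE.
have [j [_ -> _ _]] := grid_sumE (phi^~ w) (t w) (N n) (h_ge0 n).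
have [i [_ -> _ _]] := grid_sumE (phi^~ w) (s w) (N n) (h_ge0 n).
rewrite opprB addrA subrK (le_trans (ler_normB _ _))//.
by rewrite mulr2n lerD.
Qed.

Let alive_past n k : past X (k%:R * h n) (alive n k).
Proof.
have k0 : 0 <= k%:R * h n by rewrite mulr_ge0.
by apply: pastI; [exact: stopping_past|exact: stopping_gt].
Qed.

Let m_alive n k : measurable (alive n k).
Proof. exact: past_measurable (@alive_past n k). Qed.

Let m1phi n k r : measurable_fun setT (fun w => \1_(alive n k) w * phi r w).
Proof. by apply: measurable_funM => //; exact: measurable_indic. Qed.

Let int1phi n k r : P.-integrable setT (EFin \o (fun w => \1_(alive n k) w * phi r w)).
Proof.
apply: (@bounded_integrable _ _ _ _ _ M) => // w.
rewrite normrM indicE; case: (_ \in _); first by rewrite normr1 mul1r.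
by rewrite normr0 mul0r expR_ge0.
Qed.

Let int_gain n k : P.-integrable setT (EFin \o gain n k).
Proof.
rewrite [X in P.-integrable _ X](_ : _ =
  ((EFin \o (fun w => (\1_(alive n k) w * phi (k.+1%:R * h n) w)%R)) \-
   (EFin \o (fun w => (\1_(alive n k) w * phi (k%:R * h n) w)%R)))%E)//.
exact: integrableB.
Qed.

(** The mean of the bound of clamp_error for one step, with K = n.+1. *)
Let step_error (n : nat) : R :=
  let K := n.+1%:R in
  expR (`|l| * (`|b| + `|c| + 1) - K) *
  (expR (mgf_rate mu (`|l| + K) * h n) + expR (mgf_rate mu (- (`|l| + K)) * h n)).

Let Rint_gain n k : \int[P]_w gain n k w =
  \int[P]_w (\1_(alive n k) w * phi (k.+1%:R * h n) w) -
  \int[P]_w (\1_(alive n k) w * phi (k%:R * h n) w).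
Proof. by rewrite -RintegralB. Qed.

(** Up to the truncation error, the mean gain of a step is
    exp(h * mgf_rate mu l) - 1 times a nonnegative mean, hence it has the sign
    of mgf_rate mu l. *)
Let gain_bounds n k :
  (0 <= mgf_rate mu l -> - step_error n <= \int[P]_w gain n k w) /\
  (mgf_rate mu l <= 0 -> \int[P]_w gain n k w <= step_error n).
Proof.
set A := alive n k; set r := k%:R * h n; set r' := k.+1%:R * h n.
set K : R := n.+1%:R.
have r0 : 0 <= r by rewrite mulr_ge0.
have rr' : r < r'.
  by rewrite /r' -natr1 mulrDl mul1r ltrDl /h invr_gt0 exprn_gt0// ltr0n.
have r'r : r' - r = h n by rewrite /r' /r -natr1 mulrDl mul1r addrAC subrr add0r.
pose err (w : T) := expR (`|l| * (`|b| + `|c| + 1) - K) *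
  (expR ((`|l| + K) * increment X r r' w) + expR (- (`|l| + K) * increment X r r' w)).
have mI : measurable_fun setT (increment X r r') by exact: measurable_funB.
have merr : measurable_fun setT err.
  apply: measurable_funM => //; apply: measurable_funD.
    exact: measurableT_comp (measurable_expRl _) mI.
  exact: measurableT_comp (measurable_expRl _) mI.
have err0 w : 0 <= err w by rewrite mulr_ge0 ?addr_ge0 ?expR_ge0.
have interr : (\int[P]_w (err w)%:E = (step_error n)%:E)%E.
  under eq_integral do rewrite EFinM EFinD.
  rewrite ge0_integralZl//=.
  - rewrite ge0_integralD//=.
    + rewrite !(increment_mgf hX)// r'r.
      by rewrite /step_error EFinM EFinD.
    + by apply/measurable_EFinP; exact: measurableT_comp (measurable_expRl _) mI.
    + by apply/measurable_EFinP; exact: measurableT_comp (measurable_expRl _) mI.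
  - apply: emeasurable_funD.
      by apply/measurable_EFinP; exact: measurableT_comp (measurable_expRl _) mI.
    by apply/measurable_EFinP; exact: measurableT_comp (measurable_expRl _) mI.
  - by move=> w _; rewrite adde_ge0// lee_fin expR_ge0.
pose z q w := \1_A w * expR (l * X q w).
have mz q : measurable_fun setT (z q).
  apply: measurable_funM; first by apply: measurable_indic; exact: m_alive.
  exact: measurableT_comp (measurable_expRl _) (mX q).
have z0 q w : 0 <= z q w by rewrite mulr_ge0 ?expR_ge0// indicE.
pose f q w := \1_A w * phi q w.
have mf q : measurable_fun setT (f q) by exact: m1phi.
have f0 q w : 0 <= f q w by rewrite mulr_ge0 ?expR_ge0// indicE.
have intf q : P.-integrable setT (EFin \o f q) by exact: int1phi.
have Fin q : (\int[P]_w (f q w)%:E)%E \is a fin_num.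
  exact: (integrable_fin_num measurableT (intf q)).
have zr : (\int[P]_w (z r w)%:E = \int[P]_w (f r w)%:E)%E.
  apply: eq_integral => w _; rewrite /z /f /phi indicE.
  have [|_] := boolP (w \in A); last by rewrite !mul0r.
  rewrite inE => -[/= sr /ltW rt]; rewrite clamp_id//.
  by have := Xbc sr rt; lra.
have zr' : (\int[P]_w (z r' w)%:E = (expR (mgf_rate mu l * h n))%:E * \int[P]_w (f r w)%:E)%E.
  by rewrite -zr -r'r; apply: exp_step => //; exact: alive_past.
have pw w : `|z r' w - f r' w| <= err w.
  rewrite -mulrBr indicE; have [|_] := boolP (w \in A); last first.
    by rewrite mul0r normr0.
  rewrite inE => -[/= sr /ltW rt]; rewrite mul1r /phi.
  have -> : X r' w = X r w + increment X r r' w by rewrite /increment addrC subrK.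
  apply: clamp_error => //; exact: Xbc sr rt.
have le1 : (\int[P]_w (z r' w)%:E <= \int[P]_w (f r' w)%:E + (step_error n)%:E)%E.
  rewrite -interr; apply: ge0_integral_le_add => // w.
  by rewrite -lerBlDl (le_trans (ler_norm _) (pw w)).
have le2 : (\int[P]_w (f r' w)%:E <= \int[P]_w (z r' w)%:E + (step_error n)%:E)%E.
  rewrite -interr; apply: ge0_integral_le_add => // w.
  by rewrite -lerBlDl (le_trans (ler_norm _))// distrC.
have a0 : 0 <= fine (\int[P]_w (f r w)%:E).
  by apply: fine_ge0; apply: integral_ge0 => w _; rewrite lee_fin.
rewrite Rint_gain.
pose a := fine (\int[P]_w (f r w)%:E); pose a' := fine (\int[P]_w (f r' w)%:E).
have aE : (\int[P]_w (f r w)%:E = a%:E)%E by rewrite fineK.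
have aE' : (\int[P]_w (f r' w)%:E = a'%:E)%E by rewrite fineK.
move: le1 le2; rewrite zr' aE aE' -EFinM -!EFinD !lee_fin => le1 le2.
change ((0 <= mgf_rate mu l -> - step_error n <= a' - a) /\
  (mgf_rate mu l <= 0 -> a' - a <= step_error n)).
have {}a0 : 0 <= a by [].
clearbody a a'.
have hn := h_ge0 n.
split=> g0.
  have : 1 * a <= expR (mgf_rate mu l * h n) * a.
    by rewrite ler_wpM2r// -expR0 ler_expR mulr_ge0.
  by rewrite mul1r; lra.
have : expR (mgf_rate mu l * h n) * a <= 1 * a.
  by rewrite ler_wpM2r// -expR0 ler_expR mulr_le0_ge0.
by rewrite mul1r; lra.
Qed.

Let C : R := 48 * expR (`|l| * (`|b| + `|c| + 1) +
  ((`|l| + 1) * `|mu| + (`|l| + 1) ^+ 2 / 2)).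

Let error_small n : (N n)%:R * step_error n <= C / n.+1%:R.
Proof. exact: grid_error_small. Qed.

Let total_bounds n :
  (0 <= mgf_rate mu l -> - (C / n.+1%:R) <= \int[P]_w total n w) /\
  (mgf_rate mu l <= 0 -> \int[P]_w total n w <= C / n.+1%:R).
Proof.
have [_ ->] := integral_sum_integrable (N n) (int_gain n).
have NE : (N n)%:R * step_error n = \sum_(k < N n) step_error n.
  by rewrite sumr_const card_ord mulr_natl.
split => g0.
  rewrite lerNl (le_trans _ (error_small n))// -sumrN NE.
  by apply: ler_sum => k _; rewrite lerNl; exact: (gain_bounds n k).1.
rewrite (le_trans _ (error_small n))// NE.
by apply: ler_sum => k _; exact: (gain_bounds n k).2.
Qed.

Hypothesis Pfin : P [set w | (s w < +oo)%E /\ t w = +oo%E] = 0%E.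
Hypothesis mfin : measurable [set w | (s w < +oo)%E /\ t w = +oo%E].

(** The mean of exp(l X_t) - exp(l X_s), taken as 0 when s = +oo, has the sign
    of mgf_rate mu l.  That variable is passed as a function G because in the
    applications it is a combination of indicators. *)
Lemma optional_stopping (G : T -> R) : measurable_fun setT G ->
  (forall w, s w = +oo%E -> G w = 0) ->
  (forall w (q r : R), s w = q%:E -> t w = r%:E ->
     G w = expR (l * X r w) - expR (l * X q w)) ->
  (0 <= mgf_rate mu l -> 0 <= \int[P]_w G w) /\
  (mgf_rate mu l <= 0 -> \int[P]_w G w <= 0).
Proof.
move=> mG G0 GX.
have mtotal n : measurable_fun setT (total n).
  by apply: measurable_sum => k; apply: measurable_funB.
have cvgG : {ae P, forall w, setT w -> (EFin \o total^~ w) @ \oo --> (G w)%:E}.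
  exists [set w | (s w < +oo)%E /\ t w = +oo%E]; split => // w /= nG.
  apply: contrapT => nst; apply: nG => _; apply: cvg_EFin.
    by apply: nearW.
  rewrite [X in X @ _ --> _](_ : _ = fun n => total n w); last by [].
  under eq_fun do rewrite totalE.
  have [soo|soo] := eqVneq (s w) +oo%E.
    have too : t w = +oo%E by apply/eqP; rewrite -leye_eq -soo.
    rewrite G0// soo too; under eq_fun do rewrite subrr.
    exact: cvg_cst.
  have too : t w != +oo%E.
    by apply/eqP => too; apply: nst; split; rewrite // ltey.
  have sfin : s w \is a fin_num by rewrite ge0_fin_numE ?ss.1// ltey.
  have tfin : t w \is a fin_num by rewrite ge0_fin_numE ?st.1// ltey.
  have sE := fineK sfin; have tE := fineK tfin.
  have stw : fine (s w) <= fine (t w) by rewrite fine_le.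
  rewrite (GX w _ _ (esym sE) (esym tE)).
  have id_s : phi (fine (s w)) w = expR (l * X (fine (s w)) w).
    rewrite /phi clamp_id//.
    have /andP[] : b <= X (fine (s w)) w <= c.
      by apply: Xbc; rewrite ?sE// s_le_t.
    by lra.
  have id_t : phi (fine (t w)) w = expR (l * X (fine (t w)) w).
    rewrite /phi clamp_id//.
    have /andP[] : b <= X (fine (t w)) w <= c.
      by apply: Xbc; rewrite ?tE// s_le_t.
    by lra.
  rewrite -id_s -id_t.
  have -> : phi (fine (t w)) w - phi (fine (s w)) w =
    (phi (fine (t w)) w - phi 0 w) - (phi (fine (s w)) w - phi 0 w) by ring.
  rewrite -sE -tE.
  apply: cvgB; apply: grid_sum_cvg => //; rewrite fine_ge0 ?ss.1 ?st.1//.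
have DC := @dominated_convergence _ _ _ P setT measurableT
  (fun n => EFin \o total n) (EFin \o G) (EFin \o cst (M *+ 2)).
have [| | | | |intG _ cvgI] := DC.
- by move=> n; exact/measurable_EFinP.
- exact/measurable_EFinP.
- exact: cvgG.
- exact: finite_measure_integrable_cst.
- by apply: aeW => w n _ /=; rewrite lee_fin.
have cvgR : \int[P]_w total n w @[n --> \oo] --> \int[P]_w G w.
  apply: fine_cvg; rewrite fineK; first exact: cvgI.
  exact: (integrable_fin_num measurableT intG).
have cvgC : C / n.+1%:R @[n --> \oo] --> 0.
  by rewrite -(mulr0 C); apply: cvgM; [exact: cvg_cst|exact: cvg_harmonic].
split => g0.
  have cvgD : \int[P]_w total n w + C / n.+1%:R @[n --> \oo] --> \int[P]_w G w.
    by rewrite -[X in _ --> X]addr0; exact: cvgD.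
  apply: (cvgr_to_ge cvgD); apply: nearW => n.
  by rewrite -lerBlDr sub0r; exact: (total_bounds n).1.
have cvgB : \int[P]_w total n w - C / n.+1%:R @[n --> \oo] --> \int[P]_w G w.
  by rewrite -[X in _ --> X]subr0; exact: cvgB.
apply: (cvgr_to_le cvgB); apply: nearW => n.
by rewrite subr_le0; exact: (total_bounds n).2.
Qed.

End optional_stopping.

(** * The gambler's gambler_ruin from a stopping time *)

Section scale_function.
Context (R : realType).
Implicit Types mu x y a b c p q : R.

Lemma scale_gt0 mu x : 0 < x -> 0 < scale mu x.
Proof.
move=> x0; rewrite /scale; case: eqVneq => // mu0.
have [m0|m0] := ltP 0 mu.
  rewrite mulr_gt0 ?invr_gt0 ?mulr_gt0// subr_gt0 -[ltRHS]expR0 ltr_expR.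
  by rewrite mulNr mulNr oppr_lt0 !mulr_gt0.
have {}m0 : mu < 0 by rewrite lt_neqAle mu0.
rewrite nmulr_rgt0 ?invr_lt0 ?pmulr_rlt0// subr_lt0 -[ltLHS]expR0 ltr_expR.
by rewrite mulNr mulNr oppr_gt0 pmulr_llt0// pmulr_rlt0.
Qed.

(** From 1 - y <= exp(- y), since (1 + y + 2 y^2) (1 - y) >= 1 for y <= 1/2. *)
Lemma expR_le_quad (y : R) : y <= 1 / 2 -> expR y <= 1 + y + 2 * y ^+ 2.
Proof.
move=> y2.
have y1 : 0 < 1 - y by lra.
have h1 : 1 - y <= expR (- y) by have := expR_ge1Dx (- y).
have h2 : expR y * (1 - y) <= 1.
  by rewrite -[leRHS](expRxMexpNx_1 y) ler_wpM2l ?expR_ge0.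
rewrite -(ler_pM2r y1); apply: (le_trans h2).
have : 0 <= y ^+ 2 * (1 - 2 * y) by rewrite mulr_ge0 ?sqr_ge0//; lra.
rewrite (_ : (1 + y + 2 * y ^+ 2) * (1 - y) = 1 + y ^+ 2 * (1 - 2 * y)); last by ring.
by lra.
Qed.

(** The function of l vanishes at l = 0, which is therefore its minimum, so its
    derivative p x + q y there is zero. *)
Lemma first_order_eq0 (p q x y : R) : 0 <= p -> 0 <= q ->
  (forall l : R, 0 <= p * (expR (l * x) - 1) + q * (expR (l * y) - 1)) ->
  p * x + q * y = 0.
Proof.
move=> p0 q0 H; set D := p * x + q * y.
pose E := 2 * (p * x ^+ 2 + q * y ^+ 2).
have E0 : 0 <= E by rewrite mulr_ge0// addr_ge0// mulr_ge0// sqr_ge0.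
have key l : l * x <= 1 / 2 -> l * y <= 1 / 2 -> 0 <= l * D + l ^+ 2 * E.
  move=> /expR_le_quad lx /expR_le_quad ly; apply: (le_trans (H l)).
  have lxp : p * (expR (l * x) - 1) <= p * (l * x + 2 * (l * x) ^+ 2).
    by apply: ler_wpM2l => //; lra.
  have lyp : q * (expR (l * y) - 1) <= q * (l * y + 2 * (l * y) ^+ 2).
    by apply: ler_wpM2l => //; lra.
  apply: (le_trans (lerD lxp lyp)); rewrite le_eqVlt; apply/orP; left.
  by apply/eqP; rewrite /D /E; ring.
(* If 0 < e <= 1 / z then e x and e y are at most 1 / 2 in absolute value. *)
pose z := 2 * (`|x| + `|y| + 1).
have z0 : 0 < z by rewrite mulr_gt0// ltr_wpDl// addr_ge0.
have keyD e : 0 < e -> e <= z^-1 -> `|D| <= e * E.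
  move=> e0 ez.
  have ex u : `|u| <= `|x| + `|y| + 1 -> `|e * u| <= 1 / 2.
    move=> uz; rewrite normrM (gtr0_norm e0).
    apply: (@le_trans _ _ (z^-1 * (`|x| + `|y| + 1))).
      by apply: ler_pM => //; exact: ltW.
    by rewrite /z invfM -mulrA mulVf ?mulr1 ?mul1r// gt_eqF// ltr_wpDl// addr_ge0.
  have := ex x; rewrite -addrA lerDl addr_ge0// => /(_ isT).
  rewrite ler_norml => /andP[x1 x2].
  have := ex y; rewrite addrAC lerDr addr_ge0// => /(_ isT).
  rewrite ler_norml => /andP[y1 y2].
  have k1 := key _ x2 y2.
  have k2 : 0 <= - e * D + (- e) ^+ 2 * E by apply: key; rewrite mulNr; lra.
  rewrite -(ler_pM2l e0) -{1}(gtr0_norm e0) -normrM ler_norml mulrA -expr2.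
  by move: k2; rewrite sqrrN mulNr; lra.
apply/eqP; apply: contraT => D0; rewrite -/D.
have D0' : 0 < `|D| by rewrite normr_gt0.
have zi : 0 < z^-1 by rewrite invr_gt0.
have E1 : 0 < E + 1 by rewrite ltr_wpDl.
pose e := Num.min z^-1 (`|D| / (E + 1) / 2).
have e0 : 0 < e by rewrite lt_min zi !divr_gt0.
have ez : e <= z^-1 by rewrite ge_min lexx.
have := keyD e e0 ez; rewrite leNgt => /negP[].
apply: (@le_lt_trans _ _ (`|D| / (E + 1) / 2 * (E + 1))).
  by apply: ler_pM => //; [exact: ltW|rewrite ge_min lexx orbT|rewrite lerDl].
by rewrite mulrAC divfK ?gt_eqF//; lra.
Qed.

(** Here p and q are the probabilities to leave the interval from b to c at c
    and at b.  For mu <> 0 the exponent - 2 mu has rate 0 and determines p; for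
    mu = 0 all rates are nonnegative and first_order_eq0 applies. *)
Lemma ruin_algebra mu a b c p q : b < a -> a < c -> 0 <= p -> 0 <= q ->
  (forall l,
    (0 <= mgf_rate mu l -> 0 <= p * (expR (l * c) - expR (l * a)) +
                                q * (expR (l * b) - expR (l * a))) /\
    (mgf_rate mu l <= 0 -> p * (expR (l * c) - expR (l * a)) +
                           q * (expR (l * b) - expR (l * a)) <= 0)) ->
  p = (p + q) * (scale mu (a - b) / scale mu (c - b)).
Proof.
move=> ba ac p0 q0 H.
have sc : scale mu (c - b) != 0 by rewrite gt_eqF// scale_gt0//; lra.
suff key : p * scale mu (c - b) = (p + q) * scale mu (a - b).
  by rewrite mulrA -key mulfK.
rewrite /scale; case: eqVneq => mu0.
  suff E : p * (c - a) + q * (b - a) = 0.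
    have -> : p * (c - b) = (p * (c - a) + q * (b - a)) + (p + q) * (a - b) by ring.
    by rewrite E add0r.
  apply: first_order_eq0 => // l.
  have [+ _] := H l; rewrite /mgf_rate mu0 mulr0 add0r divr_ge0 ?sqr_ge0// => /(_ isT).
  have fac x : expR (l * x) = expR (l * a) * expR (l * (x - a)).
    by rewrite -expRD; congr expR; ring.
  rewrite (fac c) (fac b); set x := expR (l * a).
  rewrite (_ : _ + _ = x * (p * (expR (l * (c - a)) - 1) +
    q * (expR (l * (b - a)) - 1))); last by ring.
  by rewrite pmulr_rge0// expR_gt0.
have g0 : mgf_rate mu (- 2 * mu) = 0 by rewrite /mgf_rate; field.
have [] := H (- 2 * mu); rewrite g0 lexx => /(_ isT) H1 /(_ isT) H2.
have : p * (expR (- 2 * mu * c) - expR (- 2 * mu * a)) +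
    q * (expR (- 2 * mu * b) - expR (- 2 * mu * a)) = 0.
  by apply/eqP; rewrite eq_le H1 H2.
have fac x : expR (- 2 * mu * x) = expR (- 2 * mu * b) * expR (- 2 * mu * (x - b)).
  by rewrite -expRD; congr expR; ring.
rewrite (fac c) (fac a); set x := expR (- 2 * mu * b).
set v := expR _; set w := expR _ => E.
have {}E : x * (p * (v - w) + q * (1 - w)) = 0 by rewrite -E; ring.
have {}E : p * (v - w) + q * (1 - w) = 0.
  by move/eqP: E; rewrite mulf_eq0 gt_eqF ?expR_gt0//= => /eqP.
have -> : p * ((2 * mu)^-1 * (1 - v)) =
  (p + q) * ((2 * mu)^-1 * (1 - w)) - (2 * mu)^-1 * (p * (v - w) + q * (1 - w)).
  by ring.
by rewrite E mulr0 subr0.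
Qed.

End scale_function.

Lemma stopping_finite d (T : measurableType d) (R : realType) (X : R -> T -> R)
    (s : T -> \bar R) : (forall t, measurable_fun setT (X t)) -> stopping X s ->
  measurable [set w | (s w < +oo)%E].
Proof.
move=> mX ss; rewrite [X in measurable X](_ : _ = \bigcup_n [set w | (s w <= n%:R%:E)%E]).
  apply: bigcup_measurable => n _; apply: past_measurable => //.
  exact: stopping_past (lexx _).
apply/seteqP; split => w /=.
  move=> soo; have sfin : s w \is a fin_num by rewrite ge0_fin_numE ?ss.1.
  exists (Num.truncn (fine (s w))).+1 => //=.
  by rewrite -(fineK sfin) lee_fin ltW// truncnS_gt.
by move=> [n _ /=] sn; rewrite (le_lt_trans sn)// ltry.
Qed.

Lemma measurable_lt_stopping d (T : measurableType d) (R : realType)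
    (X : R -> T -> R) (s t : T -> \bar R) : (forall t, measurable_fun setT (X t)) ->
  stopping X s -> stopping X t -> measurable [set w | (s w < t w)%E].
Proof.
move=> mX ss st; have := stopping_finite mX (stopping_before ss st).
congr (measurable _); apply/seteqP; split => w /=; first by case: ifP.
by move=> stw; rewrite stw (lt_le_trans stw)// leey.
Qed.

Section next_level.
Context d (T : measurableType d) (R : realType) (P : probability T R).
Variables (mu : R) (X : R -> {RV P >-> R}).
Hypotheses (hX : brownian_motion mu 0 X) (X0 : forall w, X 0 w = 0).

Let mX (r : R) : measurable_fun setT (X r). Proof. exact: measurable_funP. Qed.

Let cX (w : T) : cpath (fun t => X t w). Proof. exact: bm_continuous hX w. Qed.

(** Optional stopping between s and the exit time from the interval from b to
    c, for all exponents at once.  The exit time is almost surely finite when s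
    is, by escape_null. *)
Lemma gambler_ruin (s : T -> \bar R) (a b c : R) : stopping X s ->
  (forall w r, s w = r%:E -> X r w = a) -> b < a -> a < c ->
  let up w := hit_after (fun t => X t w) (s w) c in
  let dn w := hit_after (fun t => X t w) (s w) b in
  [/\ stopping X up, stopping X dn &
    fine (P [set w | (up w < dn w)%E]) =
    fine (P [set w | (s w < +oo)%E]) * (scale mu (a - b) / scale mu (c - b))].
Proof.
move=> ss Xs ba ac up dn.
have sup : stopping X up.
  apply: stopping_hit_after => // w r sr; right.
  by rewrite (Xs _ _ sr) lt_eqF.
have sdn : stopping X dn.
  apply: stopping_hit_after => // w r sr; right.
  by rewrite (Xs _ _ sr) gt_eqF.
split => //.
pose t w := Order.min (up w) (dn w).
have st : stopping X t by exact: stopping_min.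
have s_up w : (s w <= up w)%E by exact: le_hit_after.
have s_dn w : (s w <= dn w)%E by exact: le_hit_after.
have s_t w : (s w <= t w)%E by rewrite le_min s_up s_dn.
have Xup w r : up w = r%:E -> X r w = c.
  move=> upr; have [] := @hit_after_fin _ _ (s w) c (@cX w) (ss.1 w).
    by rewrite -/(up w) upr ltry.
  by move=> r' []; rewrite -/(up w) upr => -[->].
have Xdn w r : dn w = r%:E -> X r w = b.
  move=> dnr; have [] := @hit_after_fin _ _ (s w) b (@cX w) (ss.1 w).
    by rewrite -/(dn w) dnr ltry.
  by move=> r' []; rewrite -/(dn w) dnr => -[->].
have Xbc w r : (s w <= r%:E)%E -> (r%:E <= t w)%E -> b <= X r w <= c.
  move=> sr; rewrite le_min => /andP[rup rdn].
  move: rup; rewrite le_eqVlt => /predU1P[rup|rup].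
    by rewrite (Xup _ _ (esym rup)); lra.
  move: rdn; rewrite le_eqVlt => /predU1P[rdn|rdn].
    by rewrite (Xdn _ _ (esym rdn)); lra.
  have sfin : s w \is a fin_num by rewrite ge0_fin_numE ?ss.1// (le_lt_trans sr)// ltry.
  have s0 : 0 <= fine (s w) by rewrite fine_ge0 ?ss.1.
  have sr' : fine (s w) <= r by rewrite -lee_fin fineK.
  have Xa := Xs _ _ (esym (fineK sfin)).
  rewrite /up -(fineK sfin) in rup; rewrite /dn -(fineK sfin) in rdn.
  have [+ _] := lt_hit_after (@cX w) s0 sr' rup.
  have [_ +] := lt_hit_after (@cX w) s0 sr' rdn.
  by rewrite /= Xa => /(_ ba) + /(_ ac); lra.
have bc : b <= c by lra.
pose U := [set w | (up w < dn w)%E]; pose D := [set w | (dn w < up w)%E].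
(* N: the path never leaves the interval. *)
pose N := [set w | (s w < +oo)%E /\ t w = +oo%E].
have mU : measurable U by exact: (measurable_lt_stopping mX).
have mD : measurable D by exact: (measurable_lt_stopping mX).
have mtoo : measurable [set w | t w = +oo%E].
  rewrite [X in measurable X](_ : _ = ~` [set w | (t w < +oo)%E]).
    by apply: measurableC; exact: (stopping_finite mX).
  apply/seteqP; split => w /=; first by move=> ->; rewrite ltxx.
  by move=> /negP; rewrite -leNgt leye_eq => /eqP.
have mN : measurable N.
  by apply: measurableI => //; exact: (stopping_finite mX).
have PN : P N = 0%E.
  rewrite [X in P X](_ : N =
    \bigcup_n ([set w | (s w <= n%:R%:E)%E] `&` [set w | t w = +oo%E])); last first.
    apply/seteqP; split => w /=.
      move=> [soo too]; have sfin : s w \is a fin_num by rewrite ge0_fin_numE ?ss.1.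
      exists (Num.truncn (fine (s w))).+1 => //=; split => //.
      by rewrite -(fineK sfin) lee_fin ltW// truncnS_gt.
    by move=> [n _ [/= sn too]]; split => //; rewrite (le_lt_trans sn)// ltry.
  have mS n : measurable ([set w | (s w <= n%:R%:E)%E] `&` [set w | t w = +oo%E]).
    apply: measurableI => //.
    exact: (past_measurable mX (stopping_past ss (ler0n R n) (lexx _))).
  apply: measure_negligible; first exact: bigcup_measurable.
  apply: negligible_bigcup => n; apply/negligibleP => //.
  apply: (@escape_null _ _ _ _ mu X hX X0 _ b c n%:R) => // w r [/= sn too] nr.
  apply: Xbc; last by rewrite too leey.
  by rewrite (le_trans sn)// lee_fin.
pose p := fine (P U); pose q := fine (P D).
have intI (A : set T) (k : R) : measurable A ->
    P.-integrable setT (EFin \o (fun w => k * \1_A w)) /\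
    \int[P]_w (k * \1_A w) = k * fine (P A).
  move=> mA.
  have i1 : P.-integrable setT (EFin \o (\1_A : T -> R)).
    apply: (@bounded_integrable _ _ _ _ _ 1) => // w.
    by rewrite indicE; case: (_ \in _); rewrite ?normr1 ?normr0.
  split; last by rewrite RintegralZl// /Rintegral integral_indic// setIT.
  apply: (@bounded_integrable _ _ _ _ _ `|k|) => [|w].
    by apply: measurable_funM.
  by rewrite normrM indicE; case: (_ \in _); rewrite ?normr1 ?normr0 ?mulr1 ?mulr0.
have ruin_eq l :
    (0 <= mgf_rate mu l -> 0 <= p * (expR (l * c) - expR (l * a)) +
                                q * (expR (l * b) - expR (l * a))) /\
    (mgf_rate mu l <= 0 -> p * (expR (l * c) - expR (l * a)) +
                           q * (expR (l * b) - expR (l * a)) <= 0).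
  pose kU := expR (l * c) - expR (l * a); pose kD := expR (l * b) - expR (l * a).
  pose G w : R := kU * \1_U w + kD * \1_D w.
  have -> : p * kU + q * kD = \int[P]_w G w.
    have [iU rU] := intI U kU mU; have [iD rD] := intI D kD mD.
    by rewrite RintegralD// rU rD mulrC [q * _]mulrC.
  have mG : measurable_fun setT G.
    by apply: measurable_funD; apply: measurable_funM.
  have G0 w : s w = +oo%E -> G w = 0.
    move=> soo; have upoo : up w = +oo%E by apply/eqP; rewrite -leye_eq -soo.
    have dnoo : dn w = +oo%E by apply/eqP; rewrite -leye_eq -soo.
    rewrite /G !indicE !memNset ?mulr0 ?addr0//= /U /D /= upoo dnoo;
      by rewrite ltxx.
  have GX w q' r : s w = q'%:E -> t w = r%:E -> G w = expR (l * X r w) - expR (l * X q' w).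
    move=> sq tr; rewrite (Xs _ _ sq).
    have [ud|du|ud] := ltgtP (up w) (dn w).
    - have upr : up w = r%:E by rewrite -tr /t min_l// ltW.
      rewrite (Xup _ _ upr) /G !indicE mem_set ?memNset ?mulr1 ?mulr0 ?addr0//.
      by rewrite /D/=; apply/negP; rewrite -leNgt ltW.
    - have dnr : dn w = r%:E by rewrite -tr /t min_r// ltW.
      rewrite (Xdn _ _ dnr) /G !indicE memNset ?mem_set ?mulr1 ?mulr0 ?add0r//.
      by rewrite /U/=; apply/negP; rewrite -leNgt ltW.
    - have upr : up w = r%:E by rewrite -tr /t ud minxx.
      have dnr : dn w = r%:E by rewrite -ud.
      by have := Xup _ _ upr; rewrite (Xdn _ _ dnr); lra.
  exact: (optional_stopping hX X0 ss st s_t bc Xbc PN mN mG G0 GX).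
have -> : fine (P [set w | (s w < +oo)%E]) = p + q.
  rewrite [X in P X](_ : _ = (U `|` D) `|` N).
    rewrite measureU0//; last exact: measurableU.
    rewrite measureU//; first by rewrite fineD// fin_num_measure.
    apply/seteqP; split => // w [/=]; rewrite /U /D/= => ud du.
    by have := lt_trans ud du; rewrite ltxx.
  apply/seteqP; split => w /=; last first.
    move=> [[ud|du]|[]//].
      by rewrite (le_lt_trans (s_up w))// (lt_le_trans ud)// leey.
    by rewrite (le_lt_trans (s_dn w))// (lt_le_trans du)// leey.
  move=> soo; have [ud|du|ud] := ltgtP (up w) (dn w).
  - by left; left.
  - by left; right.
  - right; split => //; rewrite /t -ud minxx.
    apply/eqP; rewrite -leye_eq leNgt; apply/negP => upoo.
    have upfin : up w \is a fin_num by rewrite ge0_fin_numE ?sup.1.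
    have := Xup _ _ (esym (fineK upfin)).
    have dnfin : dn w \is a fin_num by rewrite -ud.
    have := Xdn _ _ (esym (fineK dnfin)).
    by rewrite ud => ->; lra.
apply: ruin_algebra => //; exact: fine_ge0.
Qed.

End next_level.

(** * Climbing a ladder_time of levels above receding barriers *)

Section level_chain.
Context d (T : measurableType d) (R : realType) (P : probability T R).
Variables (mu : R) (X : R -> {RV P >-> R}).
Hypotheses (hX : brownian_motion mu 0 X) (X0 : forall w, X 0 w = 0).

Let cX (w : T) : cpath (fun t => X t w). Proof. exact: bm_continuous hX w. Qed.

(** One step of the climb: s' is the time at which c is reached after s if b
    has not been touched in between, and +oo otherwise.  The fourth clause
    describes the paths for which s' is finite; the fifth is a sufficient
    condition for finiteness. *)
Lemma next_level (s : T -> \bar R) (a b c : R) : stopping X s ->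
  (forall w r, s w = r%:E -> X r w = a) -> b < a -> a <= c ->
  exists s' : T -> \bar R, [/\ stopping X s',
    forall w r, s' w = r%:E -> X r w = c,
    fine (P [set w | (s' w < +oo)%E]) =
      fine (P [set w | (s w < +oo)%E]) * (scale mu (a - b) / scale mu (c - b)),
    forall w r', s' w = r'%:E -> exists r, [/\ s w = r%:E, r <= r' &
      forall q, r <= q <= r' -> b < X q w <= c]
  & forall w r q, s w = r%:E -> r <= q -> X q w = c ->
      (forall x, r <= x <= q -> b < X x w) -> (s' w <= q%:E)%E].
Proof.
move=> ss Xs ba; rewrite le_eqVlt => /predU1P[<-|ac].
  exists s; split => //.
  - by rewrite divff ?mulr1// gt_eqF// scale_gt0// subr_gt0.
  - move=> w r sr; exists r; split => // q.
    by rewrite -eq_le => /eqP <-; rewrite (Xs _ _ sr) ba lexx.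
  - by move=> w r q -> rq _ _; rewrite lee_fin.
have [sup sdn Pr] := gambler_ruin hX X0 ss Xs ba ac.
set up := (fun w : T => hit_after _ (s w) c) in sup Pr.
set dn := (fun w : T => hit_after _ (s w) b) in sdn Pr.
exists (fun w => if (up w < dn w)%E then up w else +oo%E); split.
- exact: stopping_before.
- move=> w r; case: ifP => // _ upr.
  have [] := @hit_after_fin _ _ (s w) c (@cX w) (ss.1 w).
    by rewrite -/(up w) upr ltry.
  by move=> r' []; rewrite -/(up w) upr => -[->].
- rewrite -Pr; congr (fine (P _)); apply/seteqP; split => w /=; first by case: ifP.
  by move=> ud; rewrite ud (lt_le_trans ud)// leey.
- move=> w r'; case: ifP => // ud upr'.
  have supw : (s w <= up w)%E by exact: le_hit_after.
  have sfin : s w \is a fin_num.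
    by rewrite ge0_fin_numE ?ss.1// (le_lt_trans supw)// upr' ltry.
  have sE := esym (fineK sfin); set r := fine (s w) in sE.
  have r0 : 0 <= r by rewrite fine_ge0 ?ss.1.
  have Xa := Xs _ _ sE.
  exists r; split => //; first by rewrite -lee_fin -sE -upr'.
  move=> q /andP[rq]; rewrite le_eqVlt => /predU1P[->|qr'].
    have [] := @hit_after_fin _ _ (s w) c (@cX w) (ss.1 w).
      by rewrite -/(up w) upr' ltry.
    by move=> r'' []; rewrite -/(up w) upr' => -[->] _ ->; rewrite lexx andbT (lt_trans ba).
  have qup : (q%:E < up w)%E by rewrite upr' lte_fin.
  have qdn := lt_trans qup ud.
  rewrite /up sE in qup; rewrite /dn sE in qdn.
  have [+ _] := lt_hit_after (@cX w) r0 rq qup.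
  have [_ +] := lt_hit_after (@cX w) r0 rq qdn.
  by rewrite /= Xa => /(_ ba) -> /(_ ac)/ltW.
- move=> w r q sr rq Xq Xb.
  have upq : (up w <= q%:E)%E by apply: hit_after_le => //; rewrite sr lee_fin.
  case: ifPn => //; rewrite -leNgt => dnup.
  have := le_trans dnup upq.
  move=> /(hit_after_leP _ _ (@cX w) (ss.1 w))[x [sx xq Xx]].
  have := Xb x; rewrite xq andbT -lee_fin -sr sx => /(_ isT).
  by rewrite Xx ltxx.
Qed.

(** Levels x 0 <= x 1 <= ... are climbed in succession, and after reaching x j
    the path must reach x j.+1 before b j.  On a finite climb, the decrease
    at a moment of step j is measured from a maximum which is at most x j.+1,
    and the current position exceeds b j: so the barriers control the maximum
    decrease from above.  Conversely a path that reaches x n and is above b j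
    at all times that follow a passage at x j succeeds in every step. *)
Lemma level_chain (x b : nat -> R) (n : nat) : x 0%N = 0 ->
  (forall j, b j < x j) -> (forall j, x j <= x j.+1) ->
  exists s : T -> \bar R, [/\ stopping X s,
    forall w r, s w = r%:E -> X r w = x n,
    fine (P [set w | (s w < +oo)%E]) =
      \prod_(j < n) (scale mu (x j - b j) / scale mu (x j.+1 - b j)),
    forall v alpha, 0 <= v -> 0 < alpha ->
      (forall j, x j.+1 - b j <= v) -> (forall j, - alpha <= b j) ->
      forall w r, s w = r%:E ->
      [/\ forall q, 0 <= q <= r -> - alpha < X q w <= x n &
          forall q q', 0 <= q -> q <= q' -> q' <= r -> X q w - X q' w <= v]
  & forall w r, 0 <= r -> x n <= X r w ->
      (forall j q q', 0 <= q -> q <= q' -> q' <= r -> X q w = x j -> b j < X q' w) ->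
      (s w <= r%:E)%E].
Proof.
move=> x0 bx xS; elim: n => [|n [s [ss Xs Ps low upp]]].
  exists (cst 0%E); split.
  - exact: stopping0.
  - by move=> w r [<-]; rewrite X0.
  - rewrite big_ord0 [X in P X](_ : _ = setT) ?probability_setT//.
    by apply/seteqP; split => // w _ /=; rewrite ltry.
  - move=> v alpha v0 a0 _ _ w r [<-]; split => [q|q q' q0 qq' q'0].
      by rewrite -eq_le => /eqP <-; rewrite X0 x0 lexx oppr_lt0 a0.
    have -> : q' = 0 by apply/eqP; rewrite eq_le q'0 (le_trans q0).
    have -> : q = 0 by apply/eqP; rewrite eq_le q0 (le_trans qq').
    by rewrite subrr.
  - by move=> w r r0 _ _; rewrite lee_fin.
have [s' [ss' Xs' Ps' low' upp']] := next_level ss Xs (bx n) (xS n).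
exists s'; split => //.
- by rewrite Ps' Ps big_ord_recr.
- move=> v alpha v0 a0 xv ab w r' s'r'.
  have [r [sr rr' Hb]] := low' _ _ s'r'.
  have [Ha Hd] := low v alpha v0 a0 xv ab _ _ sr.
  have Ha' q : 0 <= q <= r' -> - alpha < X q w <= x n.+1.
    move=> /andP[q0 qr']; have [qr|/ltW rq] := leP q r.
      have /andP[-> h] : - alpha < X q w <= x n by apply: Ha; rewrite q0.
      exact: le_trans (xS n).
    have /andP[h ->] : b n < X q w <= x n.+1 by apply: Hb; rewrite rq.
    by rewrite (le_lt_trans (ab n)).
  split => // q q' q0 qq' q'r'.
  have [q'r|/ltW rq'] := leP q' r; first exact: Hd.
  have /andP[h _] : b n < X q' w <= x n.+1 by apply: Hb; rewrite rq'.
  have /andP[_ h'] : - alpha < X q w <= x n.+1.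
    by apply: Ha'; rewrite q0 (le_trans qq').
  by have := xv n; lra.
- move=> w r r0 xr Hb.
  have sr : (s w <= r%:E)%E by apply: upp => //; exact: le_trans (xS n) xr.
  have sfin : s w \is a fin_num by rewrite ge0_fin_numE ?ss.1// (le_lt_trans sr)// ltry.
  have sE := esym (fineK sfin); set r1 := fine (s w) in sE.
  have r10 : 0 <= r1 by rewrite fine_ge0 ?ss.1.
  have r1r : r1 <= r by rewrite -lee_fin -sE.
  have X1 := Xs _ _ sE.
  have [|q /[!in_itv]/= /andP[r1q qr] Xq] := @IVT _ _ _ _ (x n.+1) r1r (cpathS (@cX w) r10).
    by rewrite X1 ge_min xS/= le_max xr orbT.
  apply: (@le_trans _ _ q%:E); last by rewrite lee_fin.
  apply: (upp' _ _ _ sE r1q Xq) => y /andP[r1y yq].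
  by apply: (Hb n r1) => //; exact: le_trans qr.
Qed.

End level_chain.

Section path_events.
Context (R : realType).
Implicit Types (f : R -> R) (u v alpha beta : R).

Lemma decrease_hit_forward f u alpha beta : cpath f -> f 0 = 0 -> 0 < alpha ->
  (max_decrease f (hitting_time f beta) < u%:E)%E ->
  (hitting_time f beta < hitting_time f (- alpha))%E ->
  exists r, [/\ 0 <= r, f r = beta, forall q, 0 <= q <= r -> - alpha < f q &
    forall q q', 0 <= q -> q <= q' -> q' <= r -> f q - f q' < u].
Proof.
move=> cf f0 a0 du hb.
rewrite [X in (X < _)%E]hit_afterE [X in (_ < X)%E]hit_afterE in hb.
have [|r [hr r0 fr]] := @hit_after_fin _ f 0%E beta cf (lexx _).
  by rewrite (lt_le_trans hb)// leey.
rewrite lee_fin in r0.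
exists r; split => // [q /andP[q0 qr]|q q' q0 qq' q'r].
  have hq : (q%:E < hit_after f 0%R%:E (- alpha))%E.
    by rewrite (le_lt_trans _ hb)// hr lee_fin.
  have [_] := lt_hit_after cf (lexx _) q0 hq.
  by rewrite f0 oppr_lt0; apply.
rewrite -lte_fin; apply: le_lt_trans du.
apply: ereal_sup_ubound; exists q, q'; split => //.
by rewrite hit_afterE hr lee_fin.
Qed.

(** The strict inequality v < u makes up for the supremum in the definition of
    the maximum decrease. *)
Lemma decrease_hit_backward f u v alpha beta r : cpath f -> v < u ->
  0 <= r -> f r = beta -> (forall q, 0 <= q <= r -> - alpha < f q) ->
  (forall q q', 0 <= q -> q <= q' -> q' <= r -> f q - f q' <= v) ->
  (max_decrease f (hitting_time f beta) < u%:E)%E /\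
  (hitting_time f beta < hitting_time f (- alpha))%E.
Proof.
move=> cf vu r0 fr Ha Hd; rewrite ![hitting_time _ _]hit_afterE.
have hr : (hit_after f 0 beta <= r%:E)%E by apply: hit_after_le => //; rewrite lee_fin.
split.
  apply: (@le_lt_trans _ _ v%:E); last by rewrite lte_fin.
  apply: ge_ereal_sup => _ [q [q' [q0 qq' q'h ->]]].
  by rewrite lee_fin; apply: Hd => //; rewrite -lee_fin (le_trans q'h).
apply: (le_lt_trans hr); rewrite ltNge; apply/negP.
move=> /(hit_after_leP _ _ cf (lexx _))[s [s0 sr fs]].
rewrite lee_fin in s0.
by have := Ha s; rewrite s0 sr fs ltxx => /(_ isT).
Qed.

End path_events.

(** * Limits of the products of gambler_ruin probabilities *)

Section limits.
Context (R : realType).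
Implicit Types mu x y w z c k : R.

Lemma cvg_nexpR (k : R) :
  n.+1%:R * (expR (k / n.+1%:R) - 1) @[n --> \oo] --> k.
Proof.
have c0 : n.+1%:R^-1 @[n --> \oo] --> (0 : R) by exact: cvg_harmonic.
apply: (@squeeze_cvgr _ _ _ _ (fun=> k) (fun n => k + 2 * k ^+ 2 * n.+1%:R^-1)).
- near=> n.
  have n0 : 0 < n.+1%:R :> R by rewrite ltr0n.
  have kn : k / n.+1%:R <= 1 / 2.
    near: n; apply: (cvgr_le (0 : R)); last by lra.
    by rewrite -[X in _ --> X](mulr0 k); apply: cvgM => //; exact: cvg_cst.
  apply/andP; split.
    rewrite -[leLHS](divfK (lt0r_neq0 n0)) mulrC ler_pM2l//.
    by rewrite lerBrDl expR_ge1Dx.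
  rewrite [leRHS](_ : _ = n.+1%:R * (k / n.+1%:R + 2 * (k / n.+1%:R) ^+ 2)); last first.
    by field; rewrite gt_eqF.
  by rewrite ler_pM2l// lerBlDl addrA; exact: expR_le_quad.
- exact: cvg_cst.
- rewrite -[X in _ --> X]addr0 -(mulr0 (2 * k ^+ 2)).
  by apply: cvgD; [exact: cvg_cst|apply: cvgM => //; exact: cvg_cst].
Unshelve. all: by end_near. Qed.

Lemma cvg_nscale mu x :
  n.+1%:R * scale mu (x / n.+1%:R) @[n --> \oo] --> x.
Proof.
rewrite /scale; case: eqVneq => mu0.
  under eq_fun do rewrite mulrC divfK ?pnatr_eq0//.
  exact: cvg_cst.
have h : - (2 * mu)^-1 * (n.+1%:R * (expR (- 2 * mu * x / n.+1%:R) - 1))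
    @[n --> \oo] --> - (2 * mu)^-1 * (- 2 * mu * x).
  by apply: cvgM; [exact: cvg_cst|exact: cvg_nexpR].
rewrite (_ : - (2 * mu)^-1 * (- 2 * mu * x) = x) in h; last by field.
apply: cvg_trans h; apply: near_eq_cvg; apply: nearW => n.
rewrite [- 2 * mu * (x / _)]mulrA.
by move: (expR _) => y; ring.
Qed.

(** Squeezed by exp(y / (1 + y)) <= 1 + y <= exp y. *)
Lemma cvg_expn_expR (y : nat -> R) (L : R) :
  n.+1%:R * y n @[n --> \oo] --> L ->
  (1 + y n) ^+ n.+1 @[n --> \oo] --> expR L.
Proof.
move=> yL.
have c0 : n.+1%:R^-1 @[n --> \oo] --> (0 : R) by exact: cvg_harmonic.
have y0 : y n @[n --> \oo] --> 0.
  have h : n.+1%:R * y n * n.+1%:R^-1 @[n --> \oo] --> L * 0 by exact: cvgM.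
  rewrite mulr0 in h; apply: cvg_trans h; apply: near_eq_cvg; apply: nearW => n.
  by rewrite mulrC mulKf ?pnatr_eq0.
apply: (@squeeze_cvgr _ _ _ _ (fun n => expR (n.+1%:R * y n / (1 + y n)))
  (fun n => expR (n.+1%:R * y n))).
- near=> n.
  have y1 : 0 < 1 + y n.
    suff : - 1 < y n by lra.
    by near: n; apply: (cvgr_gt (0 : R)) => //; rewrite oppr_lt0.
  apply/andP; split.
    rewrite -mulrA expRM_natl lerXn2r ?nnegrE ?expR_ge0 ?(ltW y1)//.
    rewrite -[leLHS]invrK -expRN -[leRHS]invrK lef_pV2 ?posrE ?expR_gt0 ?invr_gt0//.
    apply: le_trans (expR_ge1Dx _).
    rewrite le_eqVlt; apply/orP; left; apply/eqP.
    by field; rewrite gt_eqF.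
  rewrite expRM_natl lerXn2r ?nnegrE ?expR_ge0 ?(ltW y1)//.
  exact: expR_ge1Dx.
- have h : n.+1%:R * y n / (1 + y n) @[n --> \oo] --> L / (1 + 0).
    apply: cvgM => //; apply: cvgV; first by rewrite addr0 oner_neq0.
    by apply: cvgD => //; exact: cvg_cst.
  rewrite addr0 divr1 in h.
  exact: (cvg_comp _ _ h (@continuous_expR R L)).
- exact: (cvg_comp _ _ yL (@continuous_expR R L)).
Unshelve. all: by end_near. Qed.

Lemma scale_neq0 mu x : 0 < x -> scale mu x != 0.
Proof. by move=> x0; rewrite gt_eqF// scale_gt0. Qed.

(** The addition formula S^mu(w + z) = S^mu(w) + exp(- 2 mu w) S^mu(z) together
    with S^{-mu}(w) = exp(2 mu w) S^mu(w): this is where the scale function of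
    the opposite drift enters the formula. *)
Lemma scaleD mu w z : 0 < w ->
  scale mu (w + z) / scale mu w = 1 + scale mu z / scale (- mu) w.
Proof.
move=> w0; have := scale_neq0 mu w0; have := scale_neq0 (- mu) w0.
rewrite /scale oppr_eq0; case: (eqVneq mu 0) => mu0.
  by move=> _ _; field; rewrite gt_eqF.
set A := expR (- 2 * mu * w).
have A0 : A != 0 by rewrite gt_eqF// expR_gt0.
have -> : expR (- 2 * - mu * w) = A^-1 by rewrite -expRN; congr expR; ring.
have -> : expR (- 2 * mu * (w + z)) = A * expR (- 2 * mu * z).
  by rewrite -expRD; congr expR; ring.
set B := expR _ => h1 h2.
have {h2}A1 : 1 - A != 0 by apply: contraNneq h2 => ->; rewrite mulr0.
have A1' : A - 1 != 0 by rewrite -opprB oppr_eq0.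
by field; rewrite A0 A1 A1' mu0.
Qed.

Lemma cvg_scale_ratio mu w x : 0 < w ->
  (scale mu (w + x / n.+1%:R) / scale mu w) ^+ n.+1 @[n --> \oo] -->
  expR (x / scale (- mu) w).
Proof.
move=> w0; under eq_fun do rewrite scaleD//.
apply: cvg_expn_expR; under eq_fun do rewrite mulrA.
by apply: cvgM; [exact: cvg_nscale|exact: cvg_cst].
Qed.

Lemma continuous_scale mu : continuous (scale mu : R -> R).
Proof.
rewrite /scale => x; case: eqVneq => mu0; first exact: cvg_id.
apply: cvgM; first exact: cvg_cst.
apply: cvgB; first exact: cvg_cst.
have h : - 2 * mu * y @[y --> x] --> - 2 * mu * x.
  by apply: cvgM; [exact: cvg_cst|exact: cvg_id].
exact: (cvg_comp _ _ h (@continuous_expR R _)).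
Qed.

(** The limit of the probability to climb from 0 to v - a before - a, and then
    a further length l with every decrease below v. *)
Definition ladder_law mu a v l := scale mu a / scale mu v * expR (- (l / scale (- mu) v)).

Lemma cvg_ladder_upper mu a v l : 0 < v ->
  scale mu a / scale mu v * (scale mu v / scale mu (v + l / n.+1%:R)) ^+ n.+1
    @[n --> \oo] --> ladder_law mu a v l.
Proof.
move=> v0; rewrite /ladder_law; apply: cvgM; first exact: cvg_cst.
rewrite expRN; under eq_fun do rewrite -invf_div exprVn.
by apply: cvgV; [rewrite gt_eqF// expR_gt0|exact: cvg_scale_ratio].
Qed.

Lemma cvg_ladder_lower mu a v l : 0 < v ->
  scale mu a / scale mu v * (scale mu (v - l / n.+1%:R) / scale mu v) ^+ n.+1
    @[n --> \oo] --> ladder_law mu a v l.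
Proof.
move=> v0; rewrite /ladder_law; apply: cvgM; first exact: cvg_cst.
rewrite -mulNr; under eq_fun do rewrite -mulNr.
exact: cvg_scale_ratio.
Qed.

(** The lower bound is obtained with barriers raised by a fraction of a, so
    that the distance a to the first barrier stays positive. *)
Lemma cvg_ladder_law mu a v l : 0 < v ->
  ladder_law mu (a - a / n.+2%:R) (v - a / n.+2%:R) l @[n --> \oo] --> ladder_law mu a v l.
Proof.
move=> v0.
have c0 x : x - a / n.+2%:R @[n --> \oo] --> x.
  rewrite -[X in _ --> X]subr0; apply: cvgB; first exact: cvg_cst.
  rewrite -(mulr0 a); apply: cvgM; first exact: cvg_cst.
  have := @cvg_harmonic R; rewrite -(cvg_shiftS (@harmonic R)).
  by [].
have cs m x : scale m (x - a / n.+2%:R) @[n --> \oo] --> scale m x.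
  exact: (cvg_comp _ _ (c0 x) (@continuous_scale m x)).
rewrite /ladder_law; apply: cvgM.
  by apply: cvgM => //; apply: cvgV => //; exact: scale_neq0.
have h : - (l / scale (- mu) (v - a / n.+2%:R)) @[n --> \oo] --> - (l / scale (- mu) v).
  apply: cvgN; apply: cvgM; first exact: cvg_cst.
  by apply: cvgV => //; exact: scale_neq0.
exact: (cvg_comp _ _ h (@continuous_expR R _)).
Qed.

End limits.

(** * Measurability of the events *)

Section measurability.
Context d (T : measurableType d) (R : realType) (X : R -> T -> R).
Hypotheses (cX : forall w, cpath (X ^~ w)) (mX : forall t, measurable_fun setT (X t)).

Lemma stopping_hitting_time (y : R) : stopping X (fun w => hitting_time (X ^~ w) y).
Proof.
rewrite (_ : (fun w => _) = fun w => hit_after (X ^~ w) 0%E y).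
  by apply: (stopping_hit_after cX (stopping0 X)) => w r [<-]; left.
by apply/funext => w; rewrite hit_afterE.
Qed.

Lemma measurable_hits_before (y z : R) : measurable (hits_before X y z).
Proof.
exact: (measurable_lt_stopping mX (stopping_hitting_time y) (stopping_hitting_time z)).
Qed.

(** A supremum below u is below u - 1 / k.+1 for some k, and a non-strict
    bound on the decrease passes from rational times to all times.  The
    strict inequality at the right end is harmless because the second time
    can be approximated from the left; the maximum with 0 takes care of
    h = 0, where there are no rational times to test. *)
Lemma max_decrease_ltP (f : R -> R) (h : \bar R) (u : R) : cpath f -> 0 < u ->
  (0 <= h)%E -> (max_decrease f h < u%:E)%E <->
  exists k, forall q q' : rat, 0 <= ratr q :> R -> ratr q <= ratr q' :> R ->
    ((ratr q')%:E < h)%E ->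
    f (ratr q) - f (ratr q') <= Num.max 0 (u - k.+1%:R^-1).
Proof.
move=> cf u0 h0; split.
  move=> du.
  have d0 : (0 <= max_decrease f h)%E.
    by apply: ereal_sup_ubound; exists 0, 0; split => //; rewrite subrr.
  have dfin : max_decrease f h \is a fin_num by rewrite ge0_fin_numE// (lt_trans du)// ltry.
  have dE := fineK dfin; set D := fine _ in dE.
  have Du : 0 < u - D by rewrite subr_gt0 -lte_fin dE.
  exists (Num.truncn (u - D)^-1) => q q' q0 qq' q'h.
  rewrite le_max; apply/orP; right.
  apply: (@le_trans _ _ D).
    rewrite -lee_fin dE; apply: ereal_sup_ubound.
    by exists (ratr q), (ratr q'); split => //; exact: ltW.
  rewrite lerBrDl -lerBrDr invf_ple ?posrE//.
  exact/ltW/truncnS_gt.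
move=> [k Hk]; set v := Num.max _ _ in Hk.
have vu : v < u by rewrite gt_max u0/= ltrBlDr ltrDl invr_gt0.
apply: (@le_lt_trans _ _ v%:E); last by rewrite lte_fin.
apply: ge_ereal_sup => _ [s [t [s0 st th ->]]]; rewrite lee_fin.
move: st; rewrite le_eqVlt => /predU1P[->|st].
  by rewrite subrr le_max lexx.
apply/ler_addgt0Pr => e e0.
have e2 : 0 < e / 2 by rewrite divr_gt0.
have t0 : 0 < t by rewrite (le_lt_trans s0).
have [h1 h10 H1] := cpath_eps cf s0 e2.
have [h2 h20 H2] := cpath_eps cf (ltW t0) e2.
have [q [q0 qs Hq]] : exists q : rat,
    [/\ 0 <= ratr q :> R, ratr q <= s & `|f (ratr q) - f s| < e / 2].
  move: s0; rewrite le_eqVlt => /predU1P[s0|s0].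
    exists 0; rewrite rmorph0 -s0; split => //.
    by rewrite subrr normr0.
  have : Num.max 0 (s - h1) < s by rewrite gt_max s0/= ltrBlDr ltrDl.
  move=> /rat_in_itvoo[q]; rewrite in_itv/= gt_max => /andP[/andP[q0 qh] qs].
  exists q; split; [exact: ltW|exact: ltW|].
  apply: H1; first exact: ltW.
  by rewrite ltr0_norm ?subr_lt0// opprB ltrBlDr -ltrBlDl.
have [q' [q'0 q's q't Hq']] : exists q' : rat,
    [/\ 0 <= ratr q' :> R, s <= ratr q', ratr q' < t & `|f (ratr q') - f t| < e / 2].
  have : Num.max s (t - h2) < t by rewrite gt_max st/= ltrBlDr ltrDl.
  move=> /rat_in_itvoo[q']; rewrite in_itv/= gt_max => /andP[/andP[q's qh] q't].
  have q'0 := le_trans s0 (ltW q's).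
  exists q'; split => //; [exact: ltW|].
  apply: H2 => //.
  by rewrite ltr0_norm ?subr_lt0// opprB ltrBlDr -ltrBlDl.
have := Hk q q' q0 (le_trans qs q's) _.
have q'h : ((ratr q')%:E < h)%E by rewrite (lt_le_trans _ th)// lte_fin.
move=> /(_ q'h).
by move: Hq Hq'; rewrite !ltr_norml; lra.
Qed.

Lemma measurable_decrease_lt (beta u : R) : 0 < u -> measurable (decrease_lt X beta u).
Proof.
move=> u0.
have [h0 hp] := stopping_hitting_time beta.
rewrite [X in measurable X](_ : _ = \bigcup_k \bigcap_(q : rat) \bigcap_(q' : rat)
  [set w | 0 <= ratr q :> R -> ratr q <= ratr q' :> R ->
    ((ratr q')%:E < hitting_time (X ^~ w) beta)%E ->
    X (ratr q) w - X (ratr q') w <= Num.max 0 (u - k.+1%:R^-1)]); last first.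
  apply/seteqP; split => w.
    move=> /(max_decrease_ltP (@cX w) u0 (h0 w))[k Hk]; exists k => // q _ q' _.
    exact: Hk.
  move=> [k _ Hk]; apply/(max_decrease_ltP (@cX w) u0 (h0 w)); exists k => q q'.
  exact: Hk.
apply: bigcup_measurable => k _.
have capQ (F : rat -> set T) : (forall q, measurable (F q)) -> measurable (\bigcap_q F q).
  move=> mF; rewrite -[X in measurable X]setCK setC_bigcap; apply: measurableC.
  by apply: bigcupT_measurable_rat => q; exact: measurableC.
apply: (capQ) => q; apply: capQ => q'.
have [q0|q0] := leP 0 (ratr q : R); last first.
  by rewrite (_ : [set _ | _] = setT)//; apply/seteqP; split.
have [qq'|qq'] := leP (ratr q : R) (ratr q'); last first.
  by rewrite (_ : [set _ | _] = setT)//; apply/seteqP; split.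
rewrite (_ : [set _ | _] = [set w | (hitting_time (X ^~ w) beta <= (ratr q')%:E)%E] `|`
   increment X (ratr q') (ratr q) @^-1` `]-oo, Num.max 0 (u - k.+1%:R^-1)]%classic).
  apply: measurableU.
    by apply: (past_measurable mX (hp _ _)); exact: le_trans qq'.
  rewrite -[X in measurable X]setTI.
  by apply: measurable_funB.
apply/seteqP; split => w /=.
  move=> /(_ isT isT); case: leP => [_ _|_ /(_ isT)]; first by left.
  by right; rewrite in_itv.
by move=> [hq _ _|+ _ _ _]; [rewrite ltNge hq|rewrite in_itv].
Qed.

End measurability.

(** * The joint ladder_law for a process started at 0 on every path *)

Section joint_law.
Context d (T : measurableType d) (R : realType) (P : probability T R).
Variables (mu : R) (X : R -> {RV P >-> R}).
Hypotheses (hX : brownian_motion mu 0 X) (X0 : forall w, X 0 w = 0).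

Let mX (r : R) : measurable_fun setT (X r). Proof. exact: measurable_funP. Qed.

Let cX (w : T) : cpath (fun t => X t w). Proof. exact: bm_continuous hX w. Qed.

(** The chain with first barrier - a below the first level v - a, followed by n
    steps of length delta with the barrier at distance y below the current
    level.  The upper and the lower bound use it with different y. *)
Lemma ladder_time (a v y delta : R) (n : nat) : 0 < a -> a <= v -> 0 < y -> 0 <= delta ->
  exists s : T -> \bar R, [/\ stopping X s,
    fine (P [set w | (s w < +oo)%E]) =
      scale mu a / scale mu v * (scale mu y / scale mu (y + delta)) ^+ n,
    forall vm alpha, 0 <= vm -> 0 < alpha -> v <= vm -> y + delta <= vm ->
      a <= alpha -> y <= alpha + v - a -> forall w r, s w = r%:E ->
      [/\ X r w = v - a + delta *+ n,
          forall q, 0 <= q <= r -> - alpha < X q w &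
          forall q q', 0 <= q -> q <= q' -> q' <= r -> X q w - X q' w <= vm]
  & forall w r, 0 <= r -> v - a + delta *+ n <= X r w ->
      (forall q, 0 <= q <= r -> - a < X q w) ->
      (forall j q q', 0 <= q -> q <= q' -> q' <= r ->
         X q w = v - a + delta *+ j -> X q w - y < X q' w) ->
      (s w <= r%:E)%E].
Proof.
move=> a0 av y0 d0.
pose x j : R := if j is j'.+1 then v - a + delta *+ j' else 0.
pose b j : R := if j is j'.+1 then x j - y else - a.
have bx j : b j < x j by case: j => [|j]; rewrite /b /x ?oppr_lt0// ltrBlDr ltrDl.
have xS j : x j <= x j.+1.
  case: j => [|j]; rewrite /x ?mulr0n ?addr0 ?subr_ge0//.
  by rewrite mulrS lerD2l lerDr.
have x0 j : v - a <= x j.+1 by rewrite /x lerDl mulrn_wge0.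
have [s [ss Xs Ps low upp]] := level_chain hX X0 n.+1 (erefl : x 0%N = 0) bx xS.
exists s; split => //.
- rewrite Ps big_ord_recl/= /x /b /= add0r opprK mulr0n addr0 subrK; congr (_ * _).
  rewrite -[in RHS](card_ord n) -prodr_const; apply: eq_bigr => j _.
  rewrite /bump/= add1n; congr (scale _ _ / scale _ _); first by ring.
  by rewrite mulrS; ring.
- move=> vm alpha vm0 alpha0 vvm yvm aalpha yalpha w r sr.
  have [|j|H1 H2] := low vm alpha vm0 alpha0 _ _ w r sr.
  + case=> [|j]; first by rewrite /x /b mulr0n addr0 opprK subrK.
    by rewrite /b /x mulrS; apply: le_trans yvm; lra.
  + by case: j => [|j]; rewrite /b ?lerN2//; have := x0 j; lra.
  split => //; first exact: Xs _ _ sr.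
  by move=> q /H1/andP[].
- move=> w r r0 Xr Ha Hy; apply: upp => // j q q' q0 qq' q'r Xq.
  case: j Xq => [|j] Xq; first by apply: Ha; rewrite (le_trans q0).
  by rewrite /b -Xq; exact: (Hy j).
Qed.

Variables (alpha beta u : R).
Hypotheses (alpha0 : 0 < alpha) (beta0 : 0 <= beta) (u0 : 0 < u).

Let E := decrease_lt X beta u `&` hits_before X beta (- alpha).
Let a := Num.min u alpha.
Let v := Num.min u (alpha + beta).
Let l := beta + a - v.

Let mE : measurable E.
Proof.
apply: measurableI.
  exact: (measurable_decrease_lt (@cX) mX).
exact: (measurable_hits_before (@cX) mX).
Qed.

Let a_gt0 : 0 < a. Proof. by rewrite lt_min u0. Qed.

Let av : a <= v.
Proof. by rewrite le_min /a ge_min lexx/= ge_min lerDl beta0 orbT. Qed.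

Let v0 : 0 < v. Proof. exact: lt_le_trans av. Qed.

Let l0 : 0 <= l.
Proof.
rewrite /l /a /v; have := beta0; have := alpha0.
by case: (leP u alpha); case: (leP u (alpha + beta)); lra.
Qed.

Let aalpha : a <= alpha. Proof. by rewrite /a ge_min lexx orbT. Qed.
Let vu : v <= u. Proof. by rewrite /v ge_min lexx. Qed.

Let level_n n : v - a + (l / n.+1%:R) *+ n.+1 = beta.
Proof.
rewrite -mulr_natr divfK ?pnatr_eq0// /l; ring.
Qed.

(** Barriers at distance v below the level reached: paths in E never touch
    them. *)
Let PE_le n : fine (P E) <=
  scale mu a / scale mu v * (scale mu v / scale mu (v + l / n.+1%:R)) ^+ n.+1.
Proof.
have d0 : 0 <= l / n.+1%:R by rewrite divr_ge0.
have [s [ss <- _ upp]] := ladder_time n.+1 a_gt0 av v0 d0.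
have ms := stopping_finite mX ss.
apply: fine_le; rewrite ?fin_num_measure//; apply: le_measure; rewrite ?inE//.
move=> w [du hb]; have [r [r0 Xr Ha Hd]] := decrease_hit_forward (@cX w) (X0 w) alpha0 du hb.
suff : (s w <= r%:E)%E by move=> /= /le_lt_trans; apply; rewrite ltry.
apply: upp => //.
- by rewrite level_n Xr.
- move=> q /andP[q0 qr]; rewrite /a; case: (leP u alpha) => ua; last first.
    by apply: Ha; rewrite q0.
  have := Hd 0 q (lexx _) q0 qr; rewrite X0; lra.
- move=> j q q' q0 qq' q'r Xq.
  have h1 : - alpha < X q' w by apply: Ha; rewrite (le_trans q0).
  have h2 := Hd q q' q0 qq' q'r.
  have [uab|uab] := leP u (alpha + beta).
    by rewrite /v min_l//; lra.
  have vE : v = alpha + beta by rewrite /v min_r// ltW.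
  have aE : a = alpha by rewrite /a min_r//; have := beta0; lra.
  have lE : l = 0 by rewrite /l vE aE; ring.
  by rewrite Xq lE mul0r mul0rn vE aE; lra.
Qed.

(** Barriers raised so that the decrease is at most v - a / m.+2 < u: paths that
    succeed are in E. *)
Let le_PE m n : l / n.+1%:R < v - a / m.+2%:R ->
  scale mu (a - a / m.+2%:R) / scale mu (v - a / m.+2%:R) *
    (scale mu (v - a / m.+2%:R - l / n.+1%:R) / scale mu (v - a / m.+2%:R)) ^+ n.+1
  <= fine (P E).
Proof.
set e := a / m.+2%:R; set dl := l / n.+1%:R => dv.
have e0 : 0 < e by rewrite divr_gt0.
have ea : e < a by rewrite ltr_pdivrMr// ltr_pMr// ltr1n.
have d0 : 0 <= dl by rewrite divr_ge0.
have ae0 : 0 < a - e by rewrite subr_gt0.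
have aev : a - e <= v - e by rewrite lerD2r.
have y0 : 0 < v - e - dl by rewrite subr_gt0.
have [s [ss Ps low _]] := ladder_time n.+1 ae0 aev y0 d0.
rewrite subrK in Ps low; rewrite -Ps.
have ms := stopping_finite mX ss.
apply: fine_le; rewrite ?fin_num_measure//; apply: le_measure; rewrite ?inE//.
move=> w /= soo.
have sfin : s w \is a fin_num by rewrite ge0_fin_numE ?ss.1.
have sE := esym (fineK sfin); set r := fine (s w) in sE.
have r0 : 0 <= r by rewrite fine_ge0 ?ss.1.
have ve0 : 0 <= v - e by have := v0; have := av; lra.
have aea : a - e <= alpha by have := aalpha; lra.
have yalpha : v - e - dl <= alpha + (v - e) - (a - e).
  by have := aalpha; lra.
have [Xr Ha Hd] := low (v - e) alpha ve0 alpha0 (lexx _) (lexx _) aea yalpha w r sE.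
have Xb : X r w = beta by rewrite Xr -[RHS](level_n n); congr (_ + _); ring.
by apply: (decrease_hit_backward (@cX w) _ r0 Xb Ha Hd); have := vu; lra.
Qed.

Lemma joint_law : P E = (ladder_law mu a v l)%:E.
Proof.
rewrite -(fineK (fin_num_measure P E mE)); congr (_%:E).
apply/eqP; rewrite eq_le; apply/andP; split.
  by apply: (cvgr_to_ge (@cvg_ladder_upper _ mu a v l v0)); apply: nearW => n; exact: PE_le.
apply: (cvgr_to_le (@cvg_ladder_law _ mu a v l v0)); apply: nearW => m.
have ve0 : 0 < v - a / m.+2%:R.
  by rewrite subr_gt0 (lt_le_trans _ av)// ltr_pdivrMr// ltr_pMr// ltr1n.
apply: (cvgr_to_le (@cvg_ladder_lower _ mu (a - a / m.+2%:R) _ l ve0)).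
near=> n; apply: le_PE.
near: n; apply: (cvgr_lt (0 : R)) => //.
rewrite -(mulr0 l); apply: cvgM; [exact: cvg_cst|exact: cvg_harmonic].
Unshelve. all: by end_near. Qed.

End joint_law.

Section normalization.
Context d (T : measurableType d) (R : realType) (P : probability T R).
Variables (mu : R) (X : R -> {RV P >-> R}).
Hypothesis hX : brownian_motion mu 0 X.

(** Brownian motion started at 0 only almost surely, moved to 0 on every path. *)
Definition recentred (t : R) : {RV P >-> R} := (X t - X 0 : {mfun T >-> R}).

Lemma recentredE t w : recentred t w = X t w - X 0 w.
Proof. by []. Qed.

Lemma brownian_motion_recentred : brownian_motion mu 0 recentred.
Proof.
have incrE s t : increment recentred s t = increment X s t.
  by apply/funext => w; rewrite /increment !recentredE; ring.
split.
- by apply: aeW => w; rewrite recentredE subrr.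
- move=> w x; apply: (@continuousB _ _ _ ((fun t => X t w) : subspace `[0, +oo[ -> R)
    (fun=> X 0 w)); first exact: (@bm_continuous _ _ _ _ _ _ _ hX w x).
  exact: cvg_cst.
- move=> s t s0 st B mB; rewrite -(bm_increment hX s0 st mB).
  by rewrite -/(increment recentred s t) incrE.
- move=> n t t0 tn B mB; have := bm_independent hX t0 tn mB.
  rewrite (eq_bigcapr (fun i _ => congr1 (fun f => f @^-1` B i)
    (incrE (t i) (t i.+1)))) => ->.
  by apply: eq_bigr => i _; rewrite -/(increment recentred (t i) (t i.+1)) incrE.
Qed.

Lemma recentred_eq (A A' : set T) : measurable A -> measurable A' ->
  (forall w, (forall t, X t w = recentred t w) -> A w <-> A' w) -> P A = P A'.
Proof.
move=> mA mA' AA'.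
pose N := [set w | X 0 w != 0].
have mN : measurable N.
  rewrite (_ : N = X 0 @^-1` (~` [set 0])).
    by rewrite -[X in measurable X]setTI; apply: measurable_funP => //; exact: measurableC.
  by apply/seteqP; split => w /=; [move/eqP|move/eqP].
have PN : P N = 0%E.
  apply: measure_negligible => //; apply: negligibleS (bm_start hX).
  by move=> w /= /eqP.
suff key (B B' : set T) : measurable B -> measurable B' ->
    (forall w, (forall t, X t w = recentred t w) -> B w -> B' w) -> (P B <= P B')%E.
  by apply/eqP; rewrite eq_le !key// => w /AA' [].
move=> mB mB' BB'; rewrite -(measureU0 mB' mN PN).
apply: le_measure; rewrite ?inE//; first exact: measurableU.
move=> w Bw; have [w0|w0] := eqVneq (X 0 w) 0; last by right.
by left; apply: BB' Bw => t; rewrite recentredE w0 subr0.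
Qed.

End normalization.

(** * The formulas *)

Lemma scale0 (R : realType) (mu : R) : scale mu 0 = 0.
Proof. by rewrite /scale; case: eqVneq => // _; rewrite mulr0 expR0 subrr mulr0. Qed.

Section formulas.
Context d (T : measurableType d) (R : realType) (P : probability T R).
Variables (mu : R) (X : R -> {RV P >-> R}).
Hypothesis hX : brownian_motion mu 0 X.

Let Y := recentred X.

Let hY : brownian_motion mu 0 Y. Proof. exact: brownian_motion_recentred. Qed.

Let Y0 w : Y 0 w = 0. Proof. by rewrite /Y recentredE subrr. Qed.

Let mX (r : R) : measurable_fun setT (X r). Proof. exact: measurable_funP. Qed.
Let cX (w : T) : cpath (fun t => X t w). Proof. exact: bm_continuous hX w. Qed.
Let mY (r : R) : measurable_fun setT (Y r). Proof. exact: measurable_funP. Qed.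
Let cY (w : T) : cpath (fun t => Y t w). Proof. exact: bm_continuous hY w. Qed.

Variables (beta u : R).
Hypotheses (beta0 : 0 <= beta) (u0 : 0 < u).

Let recentre_joint (alpha : R) :
  P (decrease_lt X beta u `&` hits_before X beta (- alpha)) =
  P (decrease_lt Y beta u `&` hits_before Y beta (- alpha)).
Proof.
apply: (recentred_eq hX).
- apply: measurableI; first exact: (measurable_decrease_lt (@cX) mX).
  exact: (measurable_hits_before (@cX) mX).
- apply: measurableI; first exact: (measurable_decrease_lt (@cY) mY).
  exact: (measurable_hits_before (@cY) mY).
move=> w XY; rewrite /decrease_lt /hits_before /=.
by have -> : (fun t => X t w) = (fun t => Y t w) by apply/funext => t; exact: XY.
Qed.

Lemma joint_law_cases (alpha : R) : 0 <= alpha ->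
  [/\ u <= alpha ->
        P (decrease_lt X beta u `&` hits_before X beta (- alpha)) =
        (expR (- (beta / scale (- mu) u)))%:E,
      alpha <= u -> u <= alpha + beta ->
        P (decrease_lt X beta u `&` hits_before X beta (- alpha)) =
        (scale mu alpha / scale mu u *
           expR (- ((beta + alpha - u) / scale (- mu) u)))%:E
    & alpha + beta <= u ->
        P (decrease_lt X beta u `&` hits_before X beta (- alpha)) =
        (scale mu alpha / scale mu (alpha + beta))%:E].
Proof.
rewrite recentre_joint le_eqVlt => /predU1P[<-|alpha0].
  rewrite scale0 !mul0r oppr0 (_ : _ `&` _ = set0) ?measure0.
    by split => //; rewrite leNgt u0.
  apply/seteqP; split => // w [_]; rewrite /hits_before/=.
  rewrite [X in (_ < X)%E]hit_afterE ltNge => /negP; apply.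
  apply: (@le_trans _ _ 0%E); first by apply: hit_after_le; [exact: lexx|exact: Y0].
  by rewrite hit_afterE; exact: le_hit_after.
rewrite (joint_law hY Y0 alpha0 beta0 u0) /ladder_law.
split=> [ua|au uab|abu].
- have uab : u <= alpha + beta by rewrite (le_trans ua)// lerDl.
  rewrite !(min_l ua) !(min_l uab) addrK.
  by rewrite divff ?mul1r// scale_neq0.
- by rewrite (min_l uab) (min_r au).
- have au : alpha <= u by rewrite (le_trans _ abu)// lerDl.
  rewrite (min_r au) (min_r abu).
  by rewrite [beta + alpha]addrC subrr mul0r oppr0 expR0 mulr1.
Qed.

(** On the event that the maximum decrease is below u, a path that does not hit
    beta before - u never hits beta at all, and then it stays between - u and
    beta for ever. *)
Lemma decrease_law :
  P (decrease_lt X beta u) = (expR (- (beta / scale (- mu) u)))%:E.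
Proof.
have mA : measurable (decrease_lt Y beta u) by exact: (measurable_decrease_lt (@cY) mY).
have mB : measurable (hits_before Y beta (- u)) by exact: (measurable_hits_before (@cY) mY).
have -> : P (decrease_lt X beta u) = P (decrease_lt Y beta u).
  apply: (recentred_eq hX) => //; first exact: (measurable_decrease_lt (@cX) mX).
  move=> w XY; rewrite /decrease_lt /=.
  by have -> : (fun t => X t w) = (fun t => Y t w) by apply/funext => t; exact: XY.
have [H _ _] := joint_law_cases (ltW u0).
rewrite -(H (lexx u)) recentre_joint.
rewrite -[in LHS](setUIDK (decrease_lt Y beta u) (hits_before Y beta (- u))).
apply: measureU0; [exact: measurableI|exact: measurableD|].
apply: (@escape_null _ _ _ _ mu Y hY Y0 _ (- u) beta 0).
- exact: measurableD.
- by rewrite (le_trans _ beta0)// oppr_le0 ltW.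
move=> w t [dw nw] t0.
have drop q : 0 <= q -> (q%:E <= hitting_time (Y ^~ w) beta)%E -> - u < Y q w.
  move=> q0 qh; rewrite ltrNl -(add0r (- Y q w)) -{1}(Y0 w) -lte_fin.
  apply: le_lt_trans dw; apply: ereal_sup_ubound.
  by exists 0, q.
have hoo : hitting_time (Y ^~ w) beta = +oo%E.
  apply: contra_notP nw => /eqP hoo; rewrite /hits_before/= ltNge; apply/negP.
  move: hoo drop; rewrite -ltey ![hitting_time _ _]hit_afterE => hoo drop.
  have [r [hr _ _]] := hit_after_fin (@cY w) (lexx _) hoo; rewrite hr in drop *.
  move=> /(hit_after_leP _ _ (@cY w) (lexx _))[s [s0 sr Ys]].
  by have := drop s s0; rewrite lee_fin Ys ltxx => /(_ sr).
apply/andP; split; first by apply/ltW/drop => //; rewrite hoo leey.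
rewrite hit_afterE in hoo.
have tbeta : (t%:E < hit_after (Y ^~ w) 0%R%:E beta)%E by rewrite hoo ltry.
have [+ _] := lt_hit_after (@cY w) (lexx _) t0 tbeta.
rewrite Y0 => tb; apply/ltW/tb.
rewrite lt_neqAle beta0 andbT; apply/eqP => b0.
suff : (hit_after (Y ^~ w) 0%E beta <= 0)%E by rewrite hoo.
by apply: hit_after_le; [exact: lexx|rewrite Y0].
Qed.

End formulas.

Theorem proposition2p1 (d : measure_display) (T : measurableType d)
    (R : realType) (P : probability T R) (mu : R) (X : R -> {RV P >-> R})
    (hX : brownian_motion mu 0 X) :
  [/\ (forall alpha beta u : R,
        0 <= alpha -> 0 <= beta -> 0 < alpha + beta -> 0 < u ->
        [/\ u <= alpha ->
              P (decrease_lt X beta u `&` hits_before X beta (- alpha)) =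
              (expR (- (beta / scale (- mu) u)))%:E,
            alpha <= u -> u <= alpha + beta ->
              P (decrease_lt X beta u `&` hits_before X beta (- alpha)) =
              (scale mu alpha / scale mu u *
                 expR (- ((beta + alpha - u) / scale (- mu) u)))%:E
          & alpha + beta <= u ->
              P (decrease_lt X beta u `&` hits_before X beta (- alpha)) =
              (scale mu alpha / scale mu (alpha + beta))%:E]),
      (forall beta u : R, 0 <= beta -> 0 < u ->
        P (decrease_lt X beta u) = (expR (- (beta / scale (- mu) u)))%:E),
      (mu = 0 -> forall alpha beta u : R,
        0 <= alpha -> 0 <= beta -> 0 < alpha + beta -> 0 < u ->
        [/\ u <= alpha ->
              P (decrease_lt X beta u `&` hits_before X beta (- alpha)) =
              (expR (- (beta / u)))%:E,
            alpha <= u -> u <= alpha + beta ->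
              P (decrease_lt X beta u `&` hits_before X beta (- alpha)) =
              (alpha / u * expR (- ((beta + alpha - u) / u)))%:E
          & alpha + beta <= u ->
              P (decrease_lt X beta u `&` hits_before X beta (- alpha)) =
              (alpha / (alpha + beta))%:E])
    & (mu = 0 -> forall beta u : R, 0 <= beta -> 0 < u ->
        P (decrease_lt X beta u) = (expR (- (beta / u)))%:E)].
Proof.
split.
- by move=> alpha beta u alpha0 beta0 _ u0; exact: joint_law_cases.
- by move=> beta u beta0 u0; exact: decrease_law.
- move=> mu0 alpha beta u alpha0 beta0 _ u0.
  have := joint_law_cases hX beta0 u0 alpha0.
  by rewrite mu0 /scale oppr0 eqxx.
- move=> mu0 beta u beta0 u0; have := decrease_law hX beta0 u0.
  by rewrite mu0 /scale oppr0 eqxx.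
Qed.
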